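(* Let $0<q\le\infty$ and $s\in\mathbb R$. (i) If $1\le p<2$ and $t>d/2$, then $d^n(I,b^{s+t}_{p,q},b^s_{2,2})\asymp n^{-t/d}$. (ii) If $2<p\le\infty$ and $t>0$, then $d^n(I,b^{s+t}_{p,q},b^s_{2,2})\asymp n^{-t/d}$. (iii) If $0<p<1$ and $t>d(1/p-1/2)$, then there are constants $c_1,c_2>0$ with $c_1n^{-t/d}\le d^n(I,b^{s+t}_{p,q},b^s_{2,2})\le c_2n^{-t/d-1+1/p}$ for all $n$.
   Context: Sequence spaces: $\nabla=(\nabla_j)_{j\ge0}$ finite subsets of $\{1,\dots,2^d-1\}\times\mathbb Z^d$ with $C_1\le2^{-jd}|\nabla_j|\le C_2$ for all $j\ge J$ (some $0<C_1\le C_2$, $J\in\mathbb N$); $b^s_{p,q}=b^s_{p,q}(\nabla)$ is the space of sequences $a=(a_{j,\lambda})$ with $\|a\|_{b^s_{p,q}}=\big(\sum_{j\ge0}2^{j(s+d(1/2-1/p))q}(\sum_{\lambda\in\nabla_j}|a_{j,\lambda}|^p)^{q/p}\big)^{1/q}<\infty$ (sup over $j$ if $q=\infty$). $I$ is the identity. Gelfand widths: $d^n(I,F,Y)=\inf_{L_1,\dots,L_n}\sup\{\|f\|_Y:\|f\|_F\le1,\ L_i(f)=0,\ i=1,\dots,n\}$ over continuous linear functionals $L_i$ on $F$. $\asymp$: two-sided bounds with constants independent of $n$. *)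

(* Defs.v *)
From HB Require Import structures.
From mathcomp Require Import all_boot all_order all_algebra.
From mathcomp Require Import all_classical all_reals all_analysis.
Set Implicit Arguments. Unset Strict Implicit. Unset Printing Implicit Defensive.
Import Order.TTheory GRing.Theory Num.Theory.
Local Open Scope ring_scope.
Local Open Scope classical_set_scope.

Section Defs.
Variable R : realType.

(* indices lambda = (e, k) in {1..2^d-1} x Z^d *)
Definition Lam (d : nat) := (nat * {ffun 'I_d -> int})%type.

Definition seqT (d : nat) := nat -> Lam d -> R.

Definition admissible_nabla (d : nat) (nabla : nat -> seq (Lam d)) : Prop :=
  (forall j, uniq (nabla j)) /\
  (forall j l, l \in nabla j -> (1 <= l.1 <= 2 ^ d - 1)%N) /\
  exists C1 C2 : R, exists J : nat, 0 < C1 /\ C1 <= C2 /\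
    forall j, (J <= j)%N ->
      C1 <= (2%:R `^ (- (j%:R * d%:R))) * (size (nabla j))%:R <= C2.

Definition invp (p : \bar R) : R :=
  match p with EFin r => r^-1 | _ => 0 end.

Definition lp_level (d : nat) (nabla : nat -> seq (Lam d)) (p : \bar R)
  (a : seqT d) (j : nat) : R :=
  match p with
  | EFin r => (\sum_(l <- nabla j) `|a j l| `^ r) `^ (r^-1)
  | _ => \big[Num.max/0]_(l <- nabla j) `|a j l|
  end.

Definition bnorm (d : nat) (nabla : nat -> seq (Lam d)) (s : R) (p q : \bar R)
  (a : seqT d) : \bar R :=
  let w j := 2%:R `^ (j%:R * (s + d%:R * (2^-1 - invp p))) * lp_level nabla p a j in
  match q with
  | EFin r =>
      let S := (\sum_(0 <= j <oo) ((w j) `^ r)%:E)%E in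
      match S with EFin x => (x `^ (r^-1))%:E | _ => +oo%E end
  | _ => ereal_sup (range (fun j => (w j)%:E))
  end.

Definition in_b (d : nat) (nabla : nat -> seq (Lam d)) (s : R) (p q : \bar R)
  (a : seqT d) : Prop :=
  (forall j l, a j l != 0 -> l \in nabla j) /\ (bnorm nabla s p q a < +oo)%E.

Definition cont_lin_functional (d : nat) (nabla : nat -> seq (Lam d)) (s : R)
  (p q : \bar R) (L : seqT d -> R) : Prop :=
  (forall a b, in_b nabla s p q a -> in_b nabla s p q b ->
      L (fun j l => a j l + b j l) = L a + L b) /\
  (forall (c : R) a, in_b nabla s p q a -> L (fun j l => c * a j l) = c * L a) /\
  (forall a, in_b nabla s p q a -> forall e : R, 0 < e ->
     exists2 delta : R, 0 < delta & forall b, in_b nabla s p q b ->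
       (bnorm nabla s p q (fun j l => (b j l - a j l)%R) < delta%:E)%E ->
       `|L b - L a| < e).

Definition gelfand_width (d : nat) (nabla : nat -> seq (Lam d))
  (sF : R) (pF qF : \bar R) (sY : R) (pY qY : \bar R) (n : nat) : \bar R :=
  ereal_inf [set x | exists Ls : 'I_n -> (seqT d -> R),
    (forall i, cont_lin_functional nabla sF pF qF (Ls i)) /\
    x = ereal_sup [set y | exists a : seqT d,
          [/\ in_b nabla sF pF qF a, (bnorm nabla sF pF qF a <= 1)%E,
              (forall i, Ls i a = 0) & y = bnorm nabla sY pY qY a]]].

End Defs.

(* Main.v *)
Require Import Defs.
From HB Require Import structures.
From mathcomp Require Import all_boot all_order all_algebra.
From mathcomp Require Import all_classical all_reals all_analysis.
From mathcomp Require Import ring lra.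
Import Order.TTheory GRing.Theory Num.Theory.
Local Open Scope ring_scope.

(** Lower bounds: at a level with at least [2 n] coordinates, the kernel of [n]
functionals meets the cube [[-1, 1]^m] in a point with at least [m - n]
coordinates of modulus 1; its [l_p] norm is comparable to [m^(1/p)] for every
[p] at once, including [p < 1] and [p = oo].

Upper bounds: for [p > 2] one kills all coordinates of the levels [j < K],
where [2^(K d)] is of order [n]. For [p < 2] the problem reduces to weighted
[l_1] unit balls, and one kills in addition about [2^(K d - del i)]
random-sign functionals on level [K + i], with [del = t - d/2]. The needed
Kashin-Garnaev-Gluskin estimate (a kernel on which
[|x|_2^2 <= C log(e m / n) / n * |x|_1^2]) follows from Maurey's trick: every [x]
is rounded coordinatewise to a point [y] of a lattice [h Z^m] such that
[A (x - y)] and [x - y] are small and [|y|_1 <= 2 |x|_1], which holds on average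
for independent unbiased roundings and any sign matrix [A]. It remains to choose
[A] so that [A y] is not small for any of the few lattice points [y], which is
possible because [E exp(- X^2 / (6 E X^2)) <= 11/12] for every Rademacher sum
[X]. *)

Set Implicit Arguments.
Unset Strict Implicit.
Unset Printing Implicit Defensive.

(** * Sections of the l_1 ball with small l_2 radius *)

(** One of two outcomes is no worse than their weighted mean: the elementary step of both
    derandomizations below. *)
Lemma le_convex_or (R : realFieldType) (tau f0 f1 b : R) :
  0 <= tau <= 1 -> (1 - tau) * f0 + tau * f1 <= b -> f0 <= b \/ f1 <= b.
Proof.
move=> /andP[t0 t1] H; case: (leP f0 b) => h0; first by left.
right; rewrite leNgt; apply/negP => h1.
have [tE|tn] := eqVneq tau 1; first by rewrite tE in H; lra.
have : 0 < 1 - tau by rewrite subr_gt0 lt_neqAle tn.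
nra.
Qed.

Lemma eq_sum_update (R : realFieldType) (I : eqType) (A : Type) (i : I)
    (s : seq I) (v : A) (e : I -> A) (F : I -> A -> R) : i \notin s ->
  \sum_(k <- s) F k (if k == i then v else e k) = \sum_(k <- s) F k (e k).
Proof.
move=> hi; apply: eq_big_seq => k ks; case: eqP => // ki.
by rewrite ki (negPf hi) in ks.
Qed.

(* Method of conditional expectations: the right-hand side dominates the mean of
   the left-hand side over independent signs [e i], as
   [E (r + X)^4 <= r^4 + 6 r^2 V + 3 V^2] for a Rademacher sum [X] of variance [V]. *)
Lemma sign_choice (R : realFieldType) (I : eqType) (T : finType) (P : pred T)
    (w lam : T -> R) (y : T -> I -> R) (s : seq I) (r : T -> R) :
  uniq s -> (forall f, P f -> 0 <= w f) ->
  let V f := \sum_(i <- s) y f i ^+ 2 in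
  exists2 e : I -> R, (forall i, e i ^+ 2 = 1) &
    \sum_(f | P f) w f * (1 - lam f * (r f + \sum_(i <- s) e i * y f i) ^+ 2
        + lam f ^+ 2 * (r f + \sum_(i <- s) e i * y f i) ^+ 4)
    <= \sum_(f | P f) w f * (1 - lam f * (r f ^+ 2 + V f)
        + lam f ^+ 2 * (r f ^+ 4 + 6 * r f ^+ 2 * V f + 3 * V f ^+ 2)).
Proof.
move=> + w0; elim: s r => [|i s IH] r.
  move=> _ V; exists (fun=> 1) => [i|]; first by rewrite expr1n.
  apply: ler_sum => f Pf; apply: ler_wpM2l; first exact: w0.
  rewrite /V !big_nil; lra.
rewrite cons_uniq => /andP[hi us] V.
pose V' f := \sum_(k <- s) y f k ^+ 2.
have VE f : V f = y f i ^+ 2 + V' f by rewrite /V big_cons.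
pose B c f := w f * (1 - lam f * ((r f + c * y f i) ^+ 2 + V' f)
        + lam f ^+ 2 * ((r f + c * y f i) ^+ 4
        + 6 * (r f + c * y f i) ^+ 2 * V' f + 3 * V' f ^+ 2)).
pose b := \sum_(f | P f) w f * (1 - lam f * (r f ^+ 2 + V f)
        + lam f ^+ 2 * (r f ^+ 4 + 6 * r f ^+ 2 * V f + 3 * V f ^+ 2)).
have [c c2 Hc] : exists2 c : R, c ^+ 2 = 1 & \sum_(f | P f) B c f <= b.
  suff [h|h] : \sum_(f | P f) B 1 f <= b \/ \sum_(f | P f) B (-1) f <= b.
  - by exists 1 => //; rewrite expr1n.
  - by exists (-1) => //; rewrite sqrrN expr1n.
  apply: (@le_convex_or _ 2^-1); first lra.
  rewrite !mulr_sumr -big_split /=; apply: ler_sum => f Pf.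
  rewrite /B VE; move: (w0 f Pf).
  set W := w f; set l := lam f; set yy := y f i; set U := V' f; set rr := r f.
  move=> W0; rewrite -subr_ge0.
  (* The averaged fourth power contributes [yy^4] where the bound has [3 yy^4]; all other terms
     cancel. *)
  rewrite [X in 0 <= X](_ : _ = 2 * W * (l * yy ^+ 2) ^+ 2); last by field.
  by rewrite mulr_ge0 ?sqr_ge0 // mulr_ge0.
have [e e2 He] := IH (fun f => r f + c * y f i) us.
exists (fun k => if k == i then c else e k).
  by move=> k; case: eqP.
apply: le_trans Hc; apply: le_trans He.
rewrite le_eqVlt; apply/orP; left; apply/eqP; apply: eq_bigr => f _.
by rewrite big_cons eqxx (eq_sum_update _ _ (fun k v => v * y f k)) // addrA.
Qed.

(** For [z = X^2 / (6 V)] one has [exp(-z) <= 1 / (1 + z) <= 1 - z + z^2], of degree four in [X], so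
    [sign_choice] applies with [r = 0] and [lam = 1 / (6 V)]. The factor 6 minimises the outcome,
    [1 - 1/6 + 3/36 = 11/12]. *)
Lemma sign_row (R : realType) (I T : finType) (P : pred T) (w : T -> R)
    (y : T -> I -> R) :
  (forall f, P f -> 0 <= w f) -> (forall f, P f -> 0 < \sum_i y f i ^+ 2) ->
  exists2 e : I -> R, (forall i, e i ^+ 2 = 1) &
    \sum_(f | P f) w f
       * expR (- ((\sum_i e i * y f i) ^+ 2 / (6 * \sum_i y f i ^+ 2)))
    <= 11 / 12 * \sum_(f | P f) w f.
Proof.
move=> w0 V0; pose V f := \sum_i y f i ^+ 2.
have [e e2 He] := @sign_choice _ _ _ P w (fun f => (6 * V f)^-1) y
  (index_enum I) (fun=> 0) (index_enum_uniq I) w0.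
exists e => //; apply: (le_trans (le_trans _ He)).
  apply: ler_sum => f Pf; apply: ler_wpM2l; first exact: w0.
  rewrite add0r; set X := \sum_i _.
  have z0 : 0 <= X ^+ 2 / (6 * V f).
    by rewrite mulr_ge0 ?sqr_ge0 ?invr_ge0 ?mulr_ge0 ?(ltW (V0 f Pf)).
  have -> : 1 - (6 * V f)^-1 * X ^+ 2 + (6 * V f)^-1 ^+ 2 * X ^+ 4
    = 1 - X ^+ 2 / (6 * V f) + (X ^+ 2 / (6 * V f)) ^+ 2.
    by rewrite exprMn (_ : X ^+ 4 = X ^+ 2 ^+ 2) -?exprM // mulrC [X in _ + X]mulrC.
  move: z0; rewrite -/(V f); set z := X ^+ 2 / _ => z0.
  rewrite expRN; apply: (@le_trans _ _ (1 + z)^-1).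
    by rewrite lef_pV2 ?posrE ?expR_gt0 ?expR_ge1Dx //; lra.
  rewrite -[leLHS]mul1r ler_pdivrMr; last lra.
  rewrite -subr_ge0 (_ : _ - 1 = z ^+ 3); last by ring.
  exact: exprn_ge0.
rewrite mulr_sumr; apply: ler_sum => f Pf.
rewrite mulrC; apply: ler_wpM2r; first exact: w0.
rewrite -/(V f); have := V0 f Pf; rewrite -/(V f) => Vp.
rewrite le_eqVlt; apply/orP; left; apply/eqP; field.
by rewrite gt_eqF.
Qed.

(** Rows are chosen one after another; the exponential factors of the earlier rows are absorbed into
    the weight passed to [sign_row]. *)
Lemma sign_matrix (R : realType) (I T : finType) (P : pred T) (w : T -> R)
    (y : T -> I -> R) (n : nat) :
  (forall f, P f -> 0 <= w f) -> (forall f, P f -> 0 < \sum_i y f i ^+ 2) ->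
  exists2 e : nat -> I -> R, (forall a i, e a i ^+ 2 = 1) &
    \sum_(f | P f) w f
       * expR (- ((\sum_(a < n) (\sum_i e a i * y f i) ^+ 2)
                    / (6 * \sum_i y f i ^+ 2)))
    <= (11 / 12) ^+ n * \sum_(f | P f) w f.
Proof.
move=> w0 V0; elim: n => [|n [e e2 IH]].
  exists (fun _ _ => 1) => [a i|]; first by rewrite expr1n.
  rewrite expr0 mul1r; apply: ler_sum => f Pf.
  by rewrite big_ord0 mul0r oppr0 expR0 mulr1.
have [|c c2 Hc] := @sign_row R I T P (fun f => w f
       * expR (- ((\sum_(a < n) (\sum_i e a i * y f i) ^+ 2)
                    / (6 * \sum_i y f i ^+ 2)))) y _ V0.
  by move=> f Pf; rewrite mulr_ge0 ?w0 ?expR_ge0.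
exists (fun a => if a == n then c else e a) => [a i|]; first by case: eqP.
rewrite exprS -mulrA; apply: le_trans (le_trans Hc _); last first.
  by apply: ler_wpM2l => //; lra.
apply: ler_sum => f Pf; rewrite big_ord_recr /= eqxx -[leRHS]mulrA -expRD.
rewrite (_ : \sum_(i < n) _ = \sum_(a < n) (\sum_i e a i * y f i) ^+ 2).
  by rewrite mulrDl opprD.
by apply: eq_bigr => a _; rewrite ltn_eqF.
Qed.

(** [|x| / h] is rounded up with probability [tau], its fractional part, and down otherwise; [k] or
    [l] carries the result according to the sign of [x]. The variance is [h^2 tau (1 - tau)], at
    most [h^2 (k + tau) = h |x|]. *)
Lemma round_coord (R : realType) (h x : R) : 0 < h ->
  exists tau : R, exists k0 l0 k1 l1 : nat,
  let u0 := x - h * (k0%:R - l0%:R) in let u1 := x - h * (k1%:R - l1%:R) in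
  [/\ 0 <= tau <= 1, (1 - tau) * u0 + tau * u1 = 0,
      (1 - tau) * u0 ^+ 2 + tau * u1 ^+ 2 <= h * `|x| &
      (1 - tau) * (h * (k0%:R + l0%:R)) + tau * (h * (k1%:R + l1%:R)) = `|x| ].
Proof.
move=> h0; pose k := Num.truncn (`|x| / h); pose tau := `|x| / h - k%:R.
have xh0 : 0 <= `|x| / h by rewrite divr_ge0 // ltW.
have /andP[hk1 hk2] := truncn_itv xh0.
have xE : `|x| = h * (k%:R + tau) by rewrite /tau addrCA subrr addr0 mulrC divfK ?gt_eqF.
have t01 : 0 <= tau <= 1.
  by rewrite /tau subr_ge0 hk1 /= lerBlDr -natr1 addrC in hk2 *; exact: ltW.
have k0 : 0 <= k%:R :> R by [].
move: t01 => /andP[t0 t1].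
exists tau; have [xp|xn] := leP 0 x.
  exists k, 0%N, k.+1, 0%N => u0 u1.
  rewrite (ger0_norm xp) in xE; split; rewrite ?t0 // /u0 /u1 ?(ger0_norm xp) -?natr1 xE; try ring.
  rewrite -subr_ge0 [X in _ <= X](_ : _ = h ^+ 2 * (k%:R + tau ^+ 2)); last by ring.
  by rewrite mulr_ge0 ?sqr_ge0 // addr_ge0 ?sqr_ge0.
exists 0%N, k, 0%N, k.+1 => u0 u1.
have xE' : x = - (h * (k%:R + tau)) by rewrite -xE ltr0_norm // opprK.
split; rewrite ?t0 // /u0 /u1 ?(ltr0_norm xn) -?natr1 xE'; try ring.
rewrite -subr_ge0 [X in _ <= X](_ : _ = h ^+ 2 * (k%:R + tau ^+ 2)); last by ring.
by rewrite mulr_ge0 ?sqr_ge0 // addr_ge0 ?sqr_ge0.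
Qed.

(* Also by conditional expectations, now over the roundings of [x i]; lattice
   points are encoded as [h * (k - l)] with natural [k] and [l]. *)
Lemma round_vector (R : realType) (I : eqType) (n : nat) (e : nat -> I -> R)
    (x : I -> R) (h w : R) (s : seq I) (r : nat -> R) :
  0 < h -> (forall a i, e a i ^+ 2 = 1) -> uniq s ->
  exists f : I -> nat * nat,
    let u i := x i - h * ((f i).1%:R - (f i).2%:R) in
    \sum_(a < n) (r a + \sum_(i <- s) e a i * u i) ^+ 2
    + n%:R * \sum_(i <- s) u i ^+ 2
    + w * \sum_(i <- s) h * ((f i).1%:R + (f i).2%:R)
    <= \sum_(a < n) r a ^+ 2 + (2 * n%:R * h + w) * \sum_(i <- s) `|x i|.
Proof.
move=> h0 e2; elim: s r => [|i s IH] r.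
  move=> _; exists (fun=> (0%N, 0%N)); rewrite /= !big_nil !mulr0 !addr0.
  by rewrite le_eqVlt; apply/orP; left; apply/eqP; apply: eq_bigr => a _; rewrite big_nil addr0.
rewrite cons_uniq => /andP[hi us].
have [tau [k0 [l0 [k1 [l1 [t01 hm hv ha]]]]]] := round_coord (x i) h0.
pose B u c := \sum_(a < n) (r a + e a i * u) ^+ 2 + n%:R * u ^+ 2 + w * c.
pose b := \sum_(a < n) r a ^+ 2 + (2 * n%:R * h + w) * `|x i|.
(* As [e a i] has square 1, the rows contribute another [n u^2]. In the mean the term linear in [u]
   vanishes and [2 n u^2] costs at most [2 n h |x i|]. *)
have BE u c : B u c = \sum_(a < n) r a ^+ 2 + u * \sum_(a < n) (2 * r a * e a i)
    + 2 * n%:R * u ^+ 2 + w * c.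
  rewrite /B (eq_bigr (fun a : 'I_n => r a ^+ 2 + (u * (2 * r a * e a i) + u ^+ 2))).
    rewrite big_split /= big_split /= mulr_sumr sumr_const card_ord -mulr_natl.
    ring.
  by move=> a _; rewrite sqrrD exprMn e2; ring.
have [v Hv] : exists v : nat * nat,
    B (x i - h * (v.1%:R - v.2%:R)) (h * (v.1%:R + v.2%:R)) <= b.
  suff [H|H] : B (x i - h * (k0%:R - l0%:R)) (h * (k0%:R + l0%:R)) <= b \/
               B (x i - h * (k1%:R - l1%:R)) (h * (k1%:R + l1%:R)) <= b.
  - by exists (k0, l0).
  - by exists (k1, l1).
  apply: (@le_convex_or _ tau) => //; rewrite !BE /b.
  move: hm hv ha.
  set u0 := x i - _; set u1 := x i - _; set c0 := h * (k0%:R + _); set c1 := h * (k1%:R + _).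
  set S := \sum_(a < n) r a ^+ 2; set S' := \sum_(a < n) _ => hm hv ha.
  have -> : (1 - tau) * (S + u0 * S' + 2 * n%:R * u0 ^+ 2 + w * c0)
      + tau * (S + u1 * S' + 2 * n%:R * u1 ^+ 2 + w * c1)
    = S + ((1 - tau) * u0 + tau * u1) * S' + 2 * n%:R * ((1 - tau) * u0 ^+ 2 + tau * u1 ^+ 2)
      + w * ((1 - tau) * c0 + tau * c1) by ring.
  rewrite hm ha mul0r addr0 [in leRHS]mulrDl addrA lerD2r lerD2l -[leRHS]mulrA.
  by apply: ler_wpM2l => //; rewrite mulr_ge0.
have [f Hf] := IH (fun a => r a + e a i * (x i - h * (v.1%:R - v.2%:R))) us.
exists (fun j => if j == i then v else f j); move: Hf Hv.
rewrite /= !big_cons !eqxx /B /b.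
rewrite (eq_sum_update _ _ (fun j u => (x j - h * ((u.1)%:R - (u.2)%:R)) ^+ 2)) //.
rewrite (eq_sum_update _ _ (fun j u => h * ((u.1)%:R + (u.2)%:R))) //.
under [X in _ -> _ -> X + _ + _ <= _]eq_bigr => a _.
  rewrite big_cons eqxx addrA.
  rewrite (eq_sum_update _ _ (fun j u => e a j * (x j - h * ((u.1)%:R - (u.2)%:R)))) //.
  over.
rewrite /=; lra.
Qed.

(** The sum is the square of a geometric sum, hence at most [(1 + 2 th)^2]. It is the share of one
    coordinate in the total weight of the lattice points. *)
Lemma sum_pow_pairs_le (R : realType) (th : R) (N : nat) : 0 <= th <= 2^-1 ->
  \sum_(v : 'I_N * 'I_N) th ^+ (v.1 + v.2) <= expR (4 * th).
Proof.
move=> /andP[t0 t1].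
have -> : \sum_(v : 'I_N * 'I_N) th ^+ (v.1 + v.2) = (\sum_(k < N) th ^+ k) ^+ 2.
  rewrite expr2 big_distrlr /= pair_big /=.
  by apply: eq_bigr => v _; rewrite exprD.
have g0 : 0 <= \sum_(k < N) th ^+ k by apply: sumr_ge0 => k _; exact: exprn_ge0.
have g1 : \sum_(k < N) th ^+ k <= 1 + 2 * th.
  have := subrX1 th N; have := exprn_ge0 N t0.
  set p := th ^+ N; set g := \sum_(_ < _) _ in g0 *; nra.
rewrite (_ : 4 * th = 2 * th + 2 * th); last by ring.
rewrite expRD -expr2 lerXn2r ?nnegrE ?expR_ge0 //.
by apply: le_trans g1 _; exact: expR_ge1Dx.
Qed.

(** [L] stands for [log (e m / n)] and [Q] for a small multiple of [n / L]. A kernel vector [x] with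
    [Q |x|_2^2 > |x|_1^2] would round to a lattice point of large weight on which the sign matrix is
    small; the term of this single point would exceed the bound of [sign_matrix] on the whole
    sum. *)
Lemma l1_l2_section (R : realType) (I : finType) (n : nat) (L Q : R) :
  (0 < n)%N -> expR (- L) <= 2^-1 -> expR (- L) * #|I|%:R <= n%:R / 200 ->
  0 <= L -> 0 <= Q -> 6400 * Q * L <= n%:R ->
  exists2 e : nat -> I -> R, (forall a i, e a i ^+ 2 = 1) &
    forall x : I -> R, (forall a, (a < n)%N -> \sum_i e a i * x i = 0) ->
      Q * \sum_i x i ^+ 2 <= (\sum_i `|x i|) ^+ 2.
Proof.
move=> n0 t1 tm L0 Q0 QL; set th := expR (- L) in t1 tm *.
(* Bounding the coordinates keeps the family of lattice points finite; the rounding of [x] will have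
   [l_1] norm at most [128 * Q] in units of the mesh. *)
pose N := (Num.truncn (128 * Q)).+1.
(* The weights [w] have total mass at most [expR (4 * th * #|I|)], while a lattice
   point [z f] of [l_1] norm at most [128 Q] has weight at least
   [expR (- 128 Q L)]; this replaces counting the lattice points. *)
pose z (f : {ffun I -> 'I_N * 'I_N}) i : R := (f i).1%:R - (f i).2%:R.
pose w (f : {ffun I -> 'I_N * 'I_N}) := \prod_i th ^+ ((f i).1 + (f i).2).
have wE f : w f = expR (- (L * \sum_i ((f i).1%:R + (f i).2%:R))).
  rewrite /w /th mulr_sumr -sumrN expR_sum; apply: eq_bigr => i _.
  by rewrite -expRM_natr -natrD mulNr.
have [e e2 He] := @sign_matrix R I _ (fun f => 0 < \sum_i z f i ^+ 2) w z n
  (fun f _ => eq_ind_r (fun u => 0 <= u) (expR_ge0 _) (wE f)) (fun f h => h).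
exists e => // x xker; rewrite leNgt; apply/negP.
set E := \sum_i x i ^+ 2; set S := \sum_i `|x i| => SQ.
have E0 : 0 <= E by apply: sumr_ge0 => i _; exact: sqr_ge0.
have S0 : 0 <= S by apply: sumr_ge0 => i _; exact: normr_ge0.
have Ep : 0 < E by rewrite lt_neqAle E0 andbT; apply/eqP => E00; move: SQ; rewrite -E00; nra.
have Sp : 0 < S.
  rewrite lt_neqAle S0 andbT; apply: contra_ltN Ep => /eqP S00.
  rewrite /E big1 // => i _; move/esym/eqP: S00.
  rewrite psumr_eq0 => [|j _]; last exact: normr_ge0.
  by move/allP/(_ i (mem_index_enum i)) => /=; rewrite normr_eq0 => /eqP ->; rewrite expr0n.
(* With this mesh and the [l_1] weight [2 n h], the rounding budget [4 n h S] equals [n E / 16]. *)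
pose h := E / (64 * S).
have hp : 0 < h by rewrite divr_gt0 // mulr_gt0.
have hS : h * S = E / 64 by rewrite /h; field; rewrite gt_eqF.
have np : 0 < n%:R :> R by rewrite ltr0n.
have [g Hg] := round_vector n x (2 * n%:R * h) (fun=> 0) hp e2 (index_enum_uniq I).
pose u i := x i - h * ((g i).1%:R - (g i).2%:R).
pose U := \sum_i u i ^+ 2; pose W := \sum_i ((g i).1%:R + (g i).2%:R) : R.
pose X := \sum_(a < n) (0 + \sum_i e a i * u i) ^+ 2.
have {}Hg : X + n%:R * U + 2 * n%:R * h * (h * W) <= (2 * n%:R * h + 2 * n%:R * h) * S.
  by rewrite [h * W]mulr_sumr; apply: le_trans Hg _; rewrite big1 ?add0r // => a _; rewrite expr0n.
have U0 : 0 <= U by apply: sumr_ge0 => i _; exact: sqr_ge0.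
have W0 : 0 <= W by apply: sumr_ge0 => i _; rewrite addr_ge0.
have X0 : 0 <= X by apply: sumr_ge0 => i _; exact: sqr_ge0.
have {}Hg : X + n%:R * U + n%:R * (2 * h ^+ 2 * W) <= n%:R * (E / 16).
  have -> : n%:R * (E / 16) = (2 * n%:R * h + 2 * n%:R * h) * S.
    rewrite (_ : E = 64 * (h * S)); last by rewrite hS; field.
    by field.
  by apply: le_trans Hg; rewrite le_eqVlt; apply/orP; left; apply/eqP; ring.
have W1 : 0 <= n%:R * (2 * h ^+ 2 * W) by rewrite mulr_ge0 // mulr_ge0 // mulr_ge0 // sqr_ge0.
(* The [l_1] term of the budget gives [W <= 128 S^2 / E], and [S^2 < Q E] by assumption. *)
have hW : W <= 128 * Q.
  have h1 : n%:R * (2 * h ^+ 2 * W) <= n%:R * (E / 16).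
    by apply: le_trans Hg; rewrite lerDr addr_ge0 // mulr_ge0.
  rewrite ler_pM2l // in h1.
  have h2 : E * W <= 128 * S ^+ 2.
    have : 2 * (h * S) ^+ 2 * W <= E / 16 * S ^+ 2.
      rewrite exprMn mulrA mulrAC; apply: ler_wpM2r => //; exact: sqr_ge0.
    rewrite hS (_ : 2 * (E / 64) ^+ 2 * W = E * (E * W / 2048)); last by field.
    rewrite (_ : E / 16 * _ = E * (S ^+ 2 / 16)); last by field.
    rewrite ler_pM2l //; lra.
  have : E * W <= E * (128 * Q) by lra.
  by rewrite ler_pM2l.
have gN i : ((g i).1 < N)%N /\ ((g i).2 < N)%N.
  have : ((g i).1 + (g i).2)%:R <= 128 * Q.
    apply: le_trans hW; rewrite natrD /W (bigD1 i) //= lerDl.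
    by apply: sumr_ge0 => j _; rewrite addr_ge0.
  rewrite -truncn_ge_nat ?mulr_ge0 // => hi.
  by rewrite /N !ltnS; split; apply: leq_trans hi; rewrite ?leq_addr ?leq_addl.
pose f : {ffun I -> 'I_N * 'I_N} := [ffun i => (inord (g i).1, inord (g i).2)].
have fE i : ((f i).1 = (g i).1 :> nat) /\ ((f i).2 = (g i).2 :> nat).
  by rewrite ffunE /= !inordK //; case: (gN i).
have zE i : z f i = (g i).1%:R - (g i).2%:R by rewrite /z; case: (fE i) => -> ->.
set V := \sum_i z f i ^+ 2.
(* Since [x] lies in the kernel, the rows take opposite values at [h z] and at the rounding error
   [u]. *)
have hX : h ^+ 2 * \sum_(a < n) (\sum_i e a i * z f i) ^+ 2 = X.
  rewrite mulr_sumr; apply: eq_bigr => a _; rewrite add0r -exprMn -[RHS]sqrrN.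
  congr (_ ^+ 2); rewrite -sumrN mulr_sumr.
  apply/eqP; rewrite -subr_eq0 -sumrB; apply/eqP; rewrite -[RHS](xker a (ltn_ord a)).
  by apply: eq_bigr => i _; rewrite zE /u; ring.
have hV : 7 / 16 * E <= h ^+ 2 * V.
  have h1 : U <= E / 16.
    rewrite -(ler_pM2l np); apply: le_trans Hg.
    by rewrite addrAC lerDr addr_ge0.
  have : E <= 2 * U + 2 * (h ^+ 2 * V).
    rewrite /E /U /V !mulr_sumr -big_split /=; apply: ler_sum => i _.
    rewrite zE /u; set y := _%:R - _; rewrite -subr_ge0.
    rewrite (_ : _ - _ = (x i - 2 * h * y) ^+ 2) ?sqr_ge0 //; ring.
  lra.
have Vp : 0 < V.
  have : 0 < h ^+ 2 * V by apply: lt_le_trans hV; rewrite mulr_gt0.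
  by rewrite pmulr_rgt0 // exprn_gt0.
have hXV : (\sum_(a < n) (\sum_i e a i * z f i) ^+ 2) / (6 * V) <= n%:R / 42.
  rewrite ler_pdivrMr ?mulr_gt0 // -(ler_pM2l (exprn_gt0 2 hp)) hX.
  have h1 : X <= n%:R * (E / 16).
    by apply: le_trans Hg; rewrite -addrA lerDl addr_ge0 // mulr_ge0.
  apply: (le_trans h1); rewrite [leRHS](_ : _ = n%:R * (h ^+ 2 * V / 7)); last by field.
  rewrite ler_pM2l //; lra.
have lower : expR (- (L * (128 * Q)) - n%:R / 42) <=
    \sum_(f | 0 < \sum_i z f i ^+ 2) w f
       * expR (- ((\sum_(a < n) (\sum_i e a i * z f i) ^+ 2)
                    / (6 * \sum_i z f i ^+ 2))).
  rewrite (bigD1 f) //=; apply: (@le_trans _ _ (w f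
       * expR (- ((\sum_(a < n) (\sum_i e a i * z f i) ^+ 2) / (6 * V))))); last first.
    rewrite lerDl; apply: sumr_ge0 => f' _.
    by rewrite wE mulr_ge0 ?expR_ge0.
  rewrite wE -expRD ler_expR lerD ?lerN2 //.
  apply: ler_wpM2l => //; apply: le_trans hW; rewrite /W.
  by rewrite le_eqVlt; apply/orP; left; apply/eqP; apply: eq_bigr => i _; case: (fE i) => -> ->.
(* [(11/12)^n <= exp(- n / 12)]; by distributivity the total weight factors over the coordinates and
   is at most [exp(4 * th * #|I|) <= exp(n / 50)]. *)
have upper : (11 / 12) ^+ n * \sum_(f | 0 < \sum_i z f i ^+ 2) w f
    <= expR (- (n%:R / 12) + n%:R / 50).
  rewrite expRD; apply: ler_pM.
  - by apply: exprn_ge0; lra.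
  - by apply: sumr_ge0 => f' _; rewrite wE expR_ge0.
  - rewrite (_ : - (n%:R / 12) = - (12^-1) * n%:R :> R); last by ring.
    rewrite expRM_natr lerXn2r ?nnegrE ?expR_ge0 //.
    by apply: le_trans (expR_ge1Dx _); rewrite -mulN1r; lra.
  - apply: (@le_trans _ _ (\sum_f w f)).
      rewrite [leRHS](bigID (fun f => 0 < \sum_i z f i ^+ 2)) /= lerDl.
      by apply: sumr_ge0 => f' _; rewrite wE expR_ge0.
    rewrite /w -(bigA_distr_bigA (fun (i : I) (v : 'I_N * 'I_N) => th ^+ (v.1 + v.2))) /=.
    apply: (@le_trans _ _ (\prod_(i : I) expR (4 * th))).
      apply: ler_prod => i _; apply/andP; split.
        by apply: sumr_ge0 => v _; rewrite exprn_ge0 // expR_ge0.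
      by apply: sum_pow_pairs_le; rewrite expR_ge0.
    rewrite prodr_const -expRM_natr ler_expR.
    by rewrite -mulrA (_ : #|_| = #|I|) //; lra.
(* Here [128 Q L <= n / 50], while [1/50 + 1/42 < 1/12 - 1/50]: a contradiction for positive [n]. *)
have := le_trans lower (le_trans He upper); rewrite ler_expR.
move: QL np; lra.
Qed.

(** * Vertices of sections of the cube *)

(** Dimension count: adjoining to [B] the columns that select the coordinates in [A] leaves fewer
    than [m] linear conditions. *)
Lemma exists_kernel_vanishing (R : fieldType) (m n : nat) (B : 'M[R]_(m, n))
    (A : {set 'I_m}) : (n + #|A| < m)%N ->
  exists2 y : 'rV[R]_m, y != 0 & y *m B = 0 /\ forall i, i \in A -> y 0 i = 0.
Proof.
move=> hc; pose S : 'M[R]_(m, #|A|) := \matrix_(i, k) (i == enum_val k)%:R.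
pose C := row_mx B S.
have : kermx C != 0.
  rewrite -mxrank_eq0 mxrank_ker -lt0n subn_gt0.
  by apply: leq_ltn_trans hc; exact: rank_leq_col.
case/rowV0Pn => y /sub_kermxP; rewrite mul_mx_row => yC y0.
exists y => //; move: yC; rewrite -[0]hsubmxK => /eq_row_mx[yB yS].
split=> [|i iA]; first by rewrite yB linear0.
have /matrixP/(_ 0 (enum_rank_in iA i)) := yS.
rewrite linear0 !mxE; under eq_bigr do rewrite mxE enum_rankK_in //.
rewrite (bigD1 i) //= eqxx mulr1 big1 ?addr0 => [->|k ki] //.
by rewrite (negPf ki) mulr0.
Qed.

Lemma cube_section_vertex (R : realFieldType) (m n : nat) (B : 'M[R]_(m, n)) :
  exists2 x : 'rV[R]_m, x *m B = 0 &
    (forall i, `|x 0 i| <= 1) /\ (m - n <= #|[set i | `|x 0 i| == 1]%R|)%N.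
Proof.
suff H k : (k <= m - n)%N -> exists2 x : 'rV[R]_m, x *m B = 0 &
    (forall i, `|x 0 i| <= 1) /\ (k <= #|[set i | `|x 0 i| == 1]%R|)%N by exact: H.
(* A point with too few coordinates of modulus 1 is moved inside the section,
   keeping these coordinates, until another coordinate reaches modulus 1. *)
elim: k => [_|k IH hk].
  by exists 0; [rewrite mul0mx | split=> // i; rewrite mxE normr0].
have [x xB [x1 xk]] := IH (ltnW hk).
have [|lek] := ltnP k #|[set i | `|x 0 i| == 1]%R|; first by exists x.
have {xk lek} xk : #|[set i | `|x 0 i| == 1]%R| = k by apply/eqP; rewrite eqn_leq lek.
set A := [set i | `|x 0 i| == 1%R] in xk.
have hc : (n + #|A| < m)%N by rewrite xk -ltn_subRL.
have [y y0 [yB yA]] := exists_kernel_vanishing B hc.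
have [i0 hi0] : exists i0, y 0 i0 != 0.
  apply/existsP; apply: contraR y0 => /existsPn h.
  by apply/eqP/rowP => i; rewrite mxE; apply/eqP; rewrite -[_ == _]negbK.
(* The step length along [y] after which coordinate [i] reaches the face that [y] points to; the
   smallest one keeps all coordinates in the cube. *)
pose g i := (1 - Num.sg (y 0 i) * x 0 i) / `|y 0 i|.
have [i1 hi1 min1] : exists2 i1, y 0 i1 != 0 & forall i, y 0 i != 0 -> g i1 <= g i.
  by case: (arg_minP (P := fun i => y 0 i != 0) g hi0) => i1 h1 h2; exists i1.
have sgx i : Num.sg (y 0 i) * x 0 i <= 1.
  apply: le_trans (ler_norm _) _; rewrite normrM normr_sg.
  by case: (_ != 0); rewrite ?mul1r ?mul0r.
have g0 : 0 <= g i1 by rewrite /g divr_ge0 // subr_ge0.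
have ysg i : y 0 i = Num.sg (y 0 i) * `|y 0 i| by rewrite -numEsg.
have sg2 i : y 0 i != 0 -> Num.sg (y 0 i) * Num.sg (y 0 i) = 1.
  by move=> h; rewrite -expr2 sqr_sg h.
have bd i : `|x 0 i + g i1 * y 0 i| <= 1.
  have [->|yi] := eqVneq (y 0 i) 0; first by rewrite mulr0 addr0.
  have yp : 0 < `|y 0 i| by rewrite normr_gt0.
  have := min1 i yi; rewrite {2}/g ler_pdivlMr // => h.
  have := sgx i; have := x1 i; rewrite !ler_norml => /andP[h1 h2] _.
  have gy : 0 <= g i1 * `|y 0 i| by rewrite mulr_ge0 // ltW.
  have [yq|yq|yq] := ltrgt0P (y 0 i); last by rewrite yq eqxx in yi.
  - move: h gy; rewrite (gtr0_norm yq) (gtr0_sg yq); lra.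
  - move: h gy; rewrite (ltr0_norm yq) (ltr0_sg yq); lra.
exists (x + g i1 *: y); first by rewrite mulmxDl -scalemxAl xB yB scaler0 addr0.
split=> [i|]; first by rewrite !mxE.
have i1A : i1 \notin A by apply: contra hi1 => /yA ->.
have -> : k.+1 = #|i1 |: A| by rewrite cardsU1 i1A xk.
apply/subset_leq_card/fintype.subsetP => i; rewrite !inE !mxE => /orP[/eqP->|iA].
  rewrite {1}(_ : x 0 i1 = Num.sg (y 0 i1) * (Num.sg (y 0 i1) * x 0 i1)).
    rewrite [in X in _ + X](ysg i1) [X in _ + X]mulrCA -mulrDr normrM normr_sg hi1 mul1r /g.
    by rewrite divfK ?normr_eq0 // addrC subrK normr1.
  by rewrite mulrA sg2 // mul1r.
by rewrite yA ?inE // mulr0 addr0.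
Qed.

(** * Sequence space norms *)

Lemma pow2D (R : realType) (x y : R) : 2 `^ (x + y) = 2 `^ x * 2 `^ y.
Proof. by rewrite powRD // pnatr_eq0 implybT. Qed.

Lemma pow2_gt0 (R : realType) (x : R) : 0 < 2 `^ x :> R.
Proof. exact: powR_gt0. Qed.

Lemma pow2_le (R : realType) (x y : R) : x <= y -> 2 `^ x <= 2 `^ y :> R.
Proof. by apply: ler_powR; rewrite ler1n. Qed.

Lemma powR_inv_le (R : realType) (x y r : R) : 0 < r -> 0 <= x ->
  x `^ r <= y -> x <= y `^ r^-1.
Proof.
move=> r0 x0 xy; rewrite -[leLHS](powRr1 x0) -(mulfV (lt0r_neq0 r0)) powRrM.
have y0 : 0 <= y by apply: le_trans xy; exact: powR_ge0.
by apply: ge0_ler_powR => //; rewrite ?invr_ge0 ?nnegrE ?powR_ge0 ?(ltW r0).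
Qed.

(** * Power means and the embedding of [l_p] into [l_1] *)

Section PowerMeans.
Variable R : realType.
Implicit Types (I : eqType).

(** Young's inequality for each [f i / A] against 1, with [A] the power mean of exponent [rho],
    summed over the list. At [rho = 1] the conjugate exponent is infinite, whence the separate
    case. *)
Lemma sum_le_power_mean I (s : seq I) (f : I -> R) (rho : R) :
  1 <= rho -> (forall i, 0 <= f i) ->
  \sum_(i <- s) f i
    <= (size s)%:R `^ (1 - rho^-1) * (\sum_(i <- s) f i `^ rho) `^ rho^-1.
Proof.
move=> rho1 f0; have rho0 : 0 < rho by apply: lt_le_trans rho1.
have [->|rhon] := eqVneq rho 1.
  rewrite invr1 subrr powRr0 mul1r powRr1; last by apply: sumr_ge0 => i _; exact: powR_ge0.
  by apply: ler_sum => i _; rewrite powRr1.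
have {rho1 rhon} rho1 : 1 < rho by rewrite lt_neqAle eq_sym rhon.
set G := \sum_(i <- s) f i `^ rho.
have G0 : 0 <= G by apply: sumr_ge0 => i _; exact: powR_ge0.
have [s0|sn] := posnP (size s).
  by rewrite (size0nil s0) big_nil mulr_ge0 ?powR_ge0.
have mp : 0 < (size s)%:R :> R by rewrite ltr0n.
have [Gz|Gn] := eqVneq G 0.
  rewrite big_seq big1 ?mulr_ge0 ?powR_ge0 // => i si.
  move/eqP: Gz; rewrite psumr_eq0 => [/allP/(_ i si)/=|j _]; last exact: powR_ge0.
  by move/eqP/powR_eq0_eq0.
have Gp : 0 < G by rewrite lt_neqAle eq_sym Gn.
pose A := (G / (size s)%:R) `^ rho^-1.
have Ap : 0 < A by rewrite powR_gt0 // divr_gt0.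
have -> : (size s)%:R `^ (1 - rho^-1) * G `^ rho^-1 = (size s)%:R * A.
  rewrite /A powRM ?invr_ge0 ?(ltW mp) // powRD ?(gt_eqF mp) ?implybT //.
  rewrite powRr1 ?(ltW mp) // powRN -mulrA [_ * G `^ _]mulrC.
  by congr (_ * (_ * _)); rewrite -powRN -mulN1r powRrM powR_inv1 // ltW.
have AE : A `^ rho = G / (size s)%:R.
  by rewrite /A -powRrM mulVf ?gt_eqF // powRr1 // divr_ge0 // ltW.
have key i : f i / A <= (f i `^ rho / A `^ rho) / rho + (1 - rho^-1).
  have q0 : 0 < (1 - rho^-1)^-1.
    by rewrite invr_gt0 subr_gt0 invf_lt1.
  have := @conjugate_powR R (f i / A) 1 rho (1 - rho^-1)^-1.
  have -> : f i `^ rho / A `^ rho = (f i / A) `^ rho.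
    by rewrite powRM ?invr_ge0 ?(ltW Ap) // -powRN -mulN1r powRrM powR_inv1 // ltW.
  rewrite mulr1 powR1 invrK mul1r; apply=> //.
    by rewrite divr_ge0 // ltW.
  by rewrite addrC subrK.
have : (\sum_(i <- s) f i) / A <= (size s)%:R.
  rewrite mulr_suml; apply: le_trans (ler_sum _ (fun i _ => key i)) _.
  rewrite big_split /= -!mulr_suml -/G AE big_const_seq count_predT.
  rewrite iter_addr_0 -mulr_natl.
  rewrite le_eqVlt; apply/orP; left; apply/eqP; field.
  by rewrite !gt_eqF.
by rewrite ler_pdivrMr.
Qed.

(** Divided by the [l_p] quasi-norm, every entry is at most 1, hence at most its own [p]-th power,
    and these powers sum to 1. *)
Lemma sum_le_lp I (s : seq I) (f : I -> R) (p : R) :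
  0 < p -> p <= 1 -> (forall i, 0 <= f i) ->
  \sum_(i <- s) f i <= (\sum_(i <- s) f i `^ p) `^ p^-1.
Proof.
move=> p0 p1 f0; set G := \sum_(i <- s) f i `^ p.
have G0 : 0 <= G by apply: sumr_ge0 => i _; exact: powR_ge0.
have fG i : i \in s -> f i `^ p <= G.
  move=> si; rewrite /G (big_rem i si) /= lerDl.
  by apply: sumr_ge0 => j _; exact: powR_ge0.
have [Gz|Gn] := eqVneq G 0.
  rewrite big_seq big1 ?powR_ge0 // => i /fG; rewrite Gz => h.
  by apply: (@powR_eq0_eq0 _ _ p); apply/eqP; rewrite eq_le h powR_ge0.
have Gp : 0 < G by rewrite lt_neqAle eq_sym Gn.
set A := G `^ p^-1; have Ap : 0 < A by exact: powR_gt0.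
have AE : A `^ p = G by rewrite /A -powRrM mulVf ?gt_eqF // powRr1.
rewrite -[leRHS]mul1r -ler_pdivrMr // mulr_suml.
apply: (@le_trans _ _ (\sum_(i <- s) f i `^ p / G)); last first.
  by rewrite -mulr_suml -/G divff.
rewrite big_seq [leRHS]big_seq; apply: ler_sum => i si.
have [->|fn] := eqVneq (f i) 0; first by rewrite mul0r divr_ge0 ?powR_ge0.
have fp : 0 < f i by rewrite lt_neqAle eq_sym fn f0.
have -> : f i `^ p / G = (f i / A) `^ p.
  by rewrite -AE powRM ?invr_ge0 ?(ltW Ap) // -[(A `^ p)^-1]powRN -mulN1r powRrM powR_inv1 // ltW.
apply: ger1_powR => //; rewrite divr_gt0 //= ler_pdivrMr // mul1r.
by apply: powR_inv_le => //; exact: fG.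
Qed.

End PowerMeans.

(** * Level norms and continuity of functionals on one level *)

Section Norms.
Variables (R : realType) (d : nat) (nabla : nat -> seq (Lam d)).
Implicit Types (a b : seqT R d) (p q : \bar R) (s : R).

Lemma lp_level_ge0 p a j : 0 <= lp_level nabla p a j.
Proof.
case: p => [r| |] /=; first exact: powR_ge0.
all: by elim/big_ind: _ => // x y x0 y0; rewrite le_max x0.
Qed.

(** The local [w] of [bnorm] under a name; the proofs fold it by conversion. *)
Definition bterm s p a j : R :=
  2%:R `^ (j%:R * (s + d%:R * (2^-1 - invp p))) * lp_level nabla p a j.

Lemma bterm_ge0 s p a j : 0 <= bterm s p a j.
Proof. by rewrite mulr_ge0 ?powR_ge0 ?lp_level_ge0. Qed.

Lemma bterm_le_bnorm s p q a j : (0 < q)%E ->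
  ((bterm s p a j)%:E <= bnorm nabla s p q a)%E.
Proof.
case: q => [r| |] //= q0; last by apply: ereal_sup_ubound; exists j.
have r0 : 0 < r by rewrite lte_fin in q0.
have : ((bterm s p a j `^ r)%:E <= \sum_(0 <= j <oo) ((bterm s p a j) `^ r)%:E)%E.
  apply: le_trans (nneseries_lim_ge (P := xpredT) j.+1 _).
    rewrite big_nat_recr //= leeDr //; apply: sume_ge0 => i _.
    by rewrite lee_fin powR_ge0.
  by move=> i _ _; rewrite lee_fin powR_ge0.
(* An infinite sum makes the norm [+oo]; only a finite sum needs an argument. *)
rewrite -/(bterm s p a); case: (limn _) => [x| |] => [|_|_]; rewrite ?leey //.
by rewrite !lee_fin; apply: powR_inv_le => //; exact: bterm_ge0.
Qed.

Lemma bnorm_single s p q a j : (0 < q)%E ->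
  (forall k, k != j -> lp_level nabla p a k = 0) ->
  (bnorm nabla s p q a <= (bterm s p a j)%:E)%E.
Proof.
move=> + a0; have t0 k : k != j -> bterm s p a k = 0.
  by move=> kj; rewrite /bterm a0 // mulr0.
case: q => [r| |] //= q0; last first.
  apply: ge_ereal_sup => _ [k _ <-]; rewrite lee_fin -/(bterm s p a k).
  by have [->|/t0 ->] := eqVneq k j; rewrite ?bterm_ge0.
have r0 : 0 < r by rewrite lte_fin in q0.
rewrite (nneseriesD1 (P := xpredT) (n := j)) //=; last first.
  by move=> k _; rewrite lee_fin powR_ge0.
rewrite eseries0; last first.
  by move=> k _ kj; rewrite -/(bterm s p a k) t0 // powR0 ?gt_eqF.
rewrite adde0 lee_fin -powRrM mulfV ?gt_eqF // powRr1 //.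
exact: bterm_ge0.
Qed.

Definition sumsq a j : R := \sum_(l <- nabla j) a j l ^+ 2.

Lemma sumsq_ge0 a j : 0 <= sumsq a j.
Proof. by apply: sumr_ge0 => l _; exact: sqr_ge0. Qed.

Lemma bterm2E s a j : bterm s 2%:E a j = 2 `^ (j%:R * s) * (sumsq a j) `^ 2^-1.
Proof.
rewrite /bterm /= subrr mulr0 addr0; congr (_ * (_ `^ _)).
by apply: eq_bigr => l _; rewrite powR_mulrn // real_normK // num_real.
Qed.

Lemma bterm2_sqr s a j : bterm s 2%:E a j `^ 2 = 2 `^ (2 * (j%:R * s)) * sumsq a j.
Proof.
rewrite bterm2E powRM ?powR_ge0 // -!powRrM mulVf // powRr1 ?sumsq_ge0 //.
by rewrite [2 * _]mulrC.
Qed.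

Lemma bnorm22_le s a (B : R) :
  (forall n, \sum_(j < n) 2 `^ (2 * (j%:R * s)) * sumsq a j <= B) ->
  (bnorm nabla s 2%:E 2%:E a <= (B `^ 2^-1)%:E)%E.
Proof.
move=> hB; rewrite /bnorm.
have S0 : (0 <= \sum_(0 <= j <oo) ((bterm s 2%:E a j) `^ 2)%:E)%E.
  by apply: nneseries_ge0 => j _ _; rewrite lee_fin powR_ge0.
have : (\sum_(0 <= j <oo) ((bterm s 2%:E a j) `^ 2)%:E <= B%:E)%E.
  apply: lime_le.
    by apply: is_cvg_nneseries => j _ _; rewrite lee_fin powR_ge0.
  apply: nearW => n; rewrite sumEFin lee_fin big_mkord.
  by under eq_bigr do rewrite bterm2_sqr.
move: S0; rewrite -/(bterm s 2%:E a); case: (limn _) => [x| |] //.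
rewrite !lee_fin => x0 xB; apply: ge0_ler_powR => //; rewrite ?invr_ge0 // nnegrE //.
exact: le_trans xB.
Qed.

Lemma coord_le_lp p a j l : (0 < p)%E -> l \in nabla j ->
  `|a j l| <= lp_level nabla p a j.
Proof.
case: p => [r| |] //= p0 lj; last first.
  exact: (le_bigmax_seq 0 l xpredT (fun l => `|a j l|)).
have r0 : 0 < r by rewrite lte_fin in p0.
apply: powR_inv_le => //; rewrite (big_rem l lj) /= lerDl.
by apply: sumr_ge0 => k _; exact: powR_ge0.
Qed.

Lemma lp_level_le p a j (c : R) : (0 < p)%E -> 0 <= c ->
  (forall l, `|a j l| <= c) ->
  lp_level nabla p a j <= c * (size (nabla j))%:R `^ invp p.
Proof.
case: p => [r| |] //= p0 c0 ac; last first.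
  rewrite powRr0 mulr1; elim/big_ind: _ => // x y xc yc.
  by rewrite ge_max xc.
have r0 : 0 < r by rewrite lte_fin in p0.
have -> : c * (size (nabla j))%:R `^ r^-1 = (\sum_(l <- nabla j) c `^ r) `^ r^-1.
  rewrite big_const_seq count_predT iter_addr_0 -[c `^ r *+ _]mulr_natr powRM ?powR_ge0 //.
  by rewrite -powRrM mulfV ?gt_eqF // powRr1.
apply: ge0_ler_powR; rewrite ?invr_ge0 ?(ltW r0) // ?nnegrE.
- by apply: sumr_ge0 => l _; exact: powR_ge0.
- by apply: sumr_ge0 => l _; exact: powR_ge0.
- by apply: ler_sum => l _; apply: ge0_ler_powR; rewrite ?nnegrE // ltW.
Qed.

Lemma lp_level0 p a j : (0 < p)%E -> (forall l, a j l = 0) ->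
  lp_level nabla p a j = 0.
Proof.
move=> p0 a0; apply/eqP; rewrite eq_le lp_level_ge0 andbT.
rewrite -[leRHS](mul0r ((size (nabla j))%:R `^ invp p)).
by apply: lp_level_le => // l; rewrite a0 normr0.
Qed.

(** Each coordinate of [b - a] is bounded by its level norm, hence by [bnorm] up to the weight [W];
    this covers the quasi-norms as well. *)
Lemma cont_level_functional s p q j (c : Lam d -> R) : (0 < p)%E -> (0 < q)%E ->
  cont_lin_functional nabla s p q (fun a => \sum_(l <- nabla j) c l * a j l).
Proof.
move=> p0 q0; split; [|split].
- move=> a b _ _; rewrite -big_split /=; apply: eq_bigr => l _; exact: mulrDr.
- by move=> k a _; rewrite mulr_sumr; apply: eq_bigr => l _; rewrite mulrCA.
move=> a _ e e0.
pose W := 2%:R `^ (j%:R * (s + d%:R * (2^-1 - invp p))) : R.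
have W0 : 0 < W by exact: powR_gt0.
pose C := \sum_(l <- nabla j) `|c l| + 1.
have C0 : 0 < C by rewrite ltr_wpDl // sumr_ge0.
exists (W * e / C); first by rewrite divr_gt0 // mulr_gt0.
move=> b _ hb.
pose x : seqT R d := fun j l => b j l - a j l.
have hx : lp_level nabla p x j < e / C.
  rewrite -(ltr_pM2l W0) mulrA -lte_fin.
  exact: le_lt_trans (bterm_le_bnorm s p x j q0) hb.
rewrite -sumrB; apply: le_lt_trans (ler_norm_sum _ _ _) _.
apply: (@le_lt_trans _ _ (\sum_(l <- nabla j) `|c l| * lp_level nabla p x j)).
  rewrite big_seq [leRHS]big_seq; apply: ler_sum => l lj.
  by rewrite -mulrBr normrM ler_wpM2l //; exact: (coord_le_lp x p0 lj).
rewrite -mulr_suml; have := lp_level_ge0 p x j.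
have : 0 <= \sum_(l <- nabla j) `|c l| by exact: sumr_ge0.
move: hx; rewrite ltr_pdivlMr // /C; set u := lp_level _ _ _ _; set v := \sum_(_ <- _) _.
nra.
Qed.

End Norms.

(** * Upper bounds for Gelfand widths *)

Lemma pow2_nat (R : realType) (n : nat) : 2 `^ n%:R = (2 ^ n)%:R :> R.
Proof. by rewrite powR_mulrn // natrX. Qed.

Lemma pow2_natM (R : realType) (j d : nat) :
  2 `^ (j%:R * d%:R) = (2 ^ (j * d))%:R :> R.
Proof. by rewrite -natrM pow2_nat. Qed.

Lemma pow2_exprn (R : realType) (x : R) (i : nat) : (2 `^ x) ^+ i = 2 `^ (x * i%:R).
Proof. by rewrite powRrM powR_mulrn // powR_ge0. Qed.

Lemma pow2_lt1 (R : realType) (x : R) : x < 0 -> 2 `^ x < 1 :> R.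
Proof. by move=> x0; rewrite /powR pnatr_eq0 /= expR_lt1 pmulr_llt0 // ln_gt0 // ltr1n. Qed.

Lemma pow2_le1 (R : realType) (x : R) : x <= 0 -> 2 `^ x <= 1 :> R.
Proof. by move=> x0; rewrite -[leRHS](powRr0 2); exact: pow2_le. Qed.

Lemma sum_geom_le (R : realType) (r : R) (N : nat) : 0 <= r < 1 ->
  \sum_(i < N) r ^+ i <= (1 - r)^-1.
Proof.
move=> /andP[r0 r1]; have h : 0 < 1 - r by rewrite subr_gt0.
rewrite -[leRHS]mul1r ler_pdivlMr //.
have := subrX1 r N; have := exprn_ge0 N r0; set S := \sum_(_ < _) _; lra.
Qed.

(** From [exp u >= 1 + u]. It lets geometric decay absorb the logarithmic factor [1 + i] of the
    section estimate. *)
Lemma natS_le_pow2 (R : realType) (x : R) : 0 < x ->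
  exists2 C : R, 0 < C & forall i : nat, 1 + i%:R <= C * 2 `^ (x * i%:R).
Proof.
move=> x0; have l2 : 0 < ln 2 :> R by rewrite ln_gt0 // ltr1n.
pose b := x * ln 2; have b0 : 0 < b by rewrite mulr_gt0.
have C0 : 0 < 1 + b^-1 by rewrite addr_gt0 // invr_gt0.
exists (1 + b^-1) => // i.
apply: (@le_trans _ _ ((1 + b^-1) * (1 + b * i%:R))).
  rewrite (_ : (1 + b^-1) * (1 + b * i%:R) = 1 + i%:R + b^-1 + b * i%:R); last first.
    by field; rewrite gt_eqF.
  by rewrite -addrA lerDl addr_ge0 // ?invr_ge0 ?mulr_ge0 // ltW.
rewrite ler_pM2l // /powR pnatr_eq0 /=.
by apply: le_trans (expR_ge1Dx _) _; rewrite ler_expR /b mulrAC.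
Qed.

(** * Counting the functionals that force a property *)

Section Killable.
Variables (R : realType) (d : nat) (nabla : nat -> seq (Lam d)).
Variables (s : R) (p q : \bar R).
Hypotheses (p0 : (0 < p)%E) (q0 : (0 < q)%E).

(** [m] is the number of functionals spent; conjunctions add these numbers, which turns the upper
    bounds into bookkeeping. *)
Definition killable (m : nat) (Z : seqT R d -> Prop) : Prop :=
  exists2 Ls : 'I_m -> (seqT R d -> R),
    forall i, cont_lin_functional nabla s p q (Ls i) &
    forall a, (forall i, Ls i a = 0) -> Z a.

Lemma killable_sub m (Z Z' : seqT R d -> Prop) :
  (forall a, Z a -> Z' a) -> killable m Z -> killable m Z'.
Proof. by move=> ZZ [Ls cL HL]; exists Ls => // a /HL /ZZ. Qed.

Lemma killable_rows j n (e : nat -> Lam d -> R) :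
  killable n (fun a => forall k, (k < n)%N -> \sum_(l <- nabla j) e k l * a j l = 0).
Proof.
exists (fun k a => \sum_(l <- nabla j) e k l * a j l).
  by move=> i; exact: cont_level_functional.
by move=> a ha k kn; exact: (ha (Ordinal kn)).
Qed.

Lemma killableT m : killable m (fun=> True).
Proof.
by apply: killable_sub (killable_rows 0 m (fun _ _ => 0)).
Qed.

Lemma killable_and m1 m2 Z1 Z2 : killable m1 Z1 -> killable m2 Z2 ->
  killable (m1 + m2) (fun a => Z1 a /\ Z2 a).
Proof.
move=> [L1 c1 H1] [L2 c2 H2].
exists (fun i => match fintype.split i with inl k => L1 k | inr k => L2 k end).
  by move=> i; case: (fintype.split i).
move=> a ha; split.
- by apply: H1 => k; have := ha (lshift m2 k); rewrite (unsplitK (inl k)).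
- by apply: H2 => k; have := ha (rshift m1 k); rewrite (unsplitK (inr k)).
Qed.

Lemma killable_widen m m' Z : (m <= m')%N -> killable m Z -> killable m' Z.
Proof.
move=> mm kZ; rewrite -(subnKC mm).
by apply: killable_sub (killable_and kZ (killableT _)) => a [].
Qed.

Lemma killable_forall N (m : nat -> nat) (Z : nat -> seqT R d -> Prop) :
  (forall i, (i < N)%N -> killable (m i) (Z i)) ->
  killable (\sum_(i < N) m i) (fun a => forall i, (i < N)%N -> Z i a).
Proof.
elim: N => [_|N IH H]; first by rewrite big_ord0; apply: killable_sub (killableT _).
rewrite big_ord_recr /=.
apply: killable_sub (killable_and (IH _) (H N (ltnSn N))).
  by move=> a [h1 h2] i; rewrite ltnS leq_eqVlt => /orP[/eqP->|/h1].
by move=> i iN; apply: H; exact: ltnW.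
Qed.

Lemma killable_level j : uniq (nabla j) ->
  killable (size (nabla j)) (fun a => sumsq nabla a j = 0).
Proof.
move=> uj; apply: killable_sub (killable_rows j _
  (fun k l => (k == index l (nabla j))%:R)) => a ha.
rewrite /sumsq big_seq big1 // => l lj.
have := ha (index l (nabla j)); rewrite index_mem => /(_ lj).
rewrite (bigD1_seq l) //= eqxx mul1r big_seq_cond big1 ?addr0 => [->|k].
  by rewrite expr0n.
case/andP=> kj kl; case: eqP => [e|_]; last by rewrite mul0r.
case/eqP: kl; rewrite -(nth_index l kj) -e.
exact: nth_index.
Qed.

Lemma killable_width m Z (sY : R) (pY qY : \bar R) (c : R) :
  killable m Z ->
  (forall a, in_b nabla s p q a -> (bnorm nabla s p q a <= 1)%E -> Z a ->
     (bnorm nabla sY pY qY a <= c%:E)%E) ->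
  (gelfand_width nabla s p q sY pY qY m <= c%:E)%E.
Proof.
move=> [Ls cL HL] H; apply: le_trans (ereal_inf_lbound _) _.
  by exists Ls; split; [exact: cL | reflexivity].
by apply: ge_ereal_sup => _ [a [ab a1 La ->]]; apply: H => //; exact: HL.
Qed.

End Killable.

(** * Upper bounds from level decay *)

Section Upper.
Variables (R : realType) (d : nat) (nabla : nat -> seq (Lam d)) (D : nat).
Hypotheses (d0 : (0 < d)%N) (D0 : (0 < D)%N).
Hypothesis uniq_nabla : forall j, uniq (nabla j).
Hypothesis size_nabla : forall j, (size (nabla j) <= D * 2 ^ (j * d))%N.
Variables (sF : R) (p q : \bar R).
Hypotheses (p0 : (0 < p)%E) (q0 : (0 < q)%E).

Lemma sum_shift_geom_le (sg : R) (K N : nat) : 0 <= sg < 1 ->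
  \sum_(j < N) (if (j < K)%N then 0 else sg ^+ (j - K)) <= (1 - sg)^-1.
Proof.
move=> sg01; have /andP[sg0 _] := sg01.
pose F (j : nat) := if (j < K)%N then 0 else sg ^+ (j - K).
have F0 j : 0 <= F j by rewrite /F; case: ifP => // _; exact: exprn_ge0.
apply: (@le_trans _ _ (\sum_(j < N + K) F j)).
  by rewrite big_split_ord /= lerDl sumr_ge0.
rewrite addnC big_split_ord /= big1 ?add0r => [|i _]; last by rewrite /F ltn_ord.
apply: le_trans (sum_geom_le N sg01); apply: ler_sum => i _.
by rewrite /F ltnNge leq_addr /= addKn.
Qed.

(** For given [n] the largest affordable [K] is used, so that [2^(K d)] is of order [n]. The [- 1]
    makes [K = 0] free, hence some [K] is affordable for every [n]. *)
Lemma width_upper (s t G sg : R) (A : nat) :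
  0 < t -> 0 < G -> 0 <= sg < 1 -> (0 < A)%N ->
  (forall K, killable nabla sF p q (A * (2 ^ (K * d) - 1)) (fun a =>
     in_b nabla sF p q a -> (bnorm nabla sF p q a <= 1)%E ->
     (forall j, (j < K)%N -> sumsq nabla a j = 0) /\
     (forall i, 2 `^ (2 * ((K + i)%:R * s)) * sumsq nabla a (K + i)
        <= G * 2 `^ (- (2 * K%:R * t)) * sg ^+ i))) ->
  exists2 c2 : R, 0 < c2 & forall n : nat, (0 < n)%N ->
    (gelfand_width nabla sF p q s 2%:E 2%:E n
       <= (c2 * n%:R `^ (- (t / d%:R)))%:E)%E.
Proof.
move=> t0 G0 sg01 A0 H; have /andP[_ sg1] := sg01.
have sgp : 0 < 1 - sg by rewrite subr_gt0.
have dp : 0 < d%:R :> R by rewrite ltr0n.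
have td0 : 0 <= t / d%:R by rewrite ltW // divr_gt0.
(* [c] comes from summing the geometric tail and taking the root, [M] from turning [2^(- K t)] into
   a power of [n]. *)
pose c := (G / (1 - sg)) `^ 2^-1; pose M : R := (A%:R * 2 `^ d%:R) `^ (t / d%:R).
have M0 : 0 < M by rewrite powR_gt0 // mulr_gt0 ?ltr0n ?pow2_gt0.
exists (c * M) => [|n n0].
  by rewrite mulr_gt0 // powR_gt0 // divr_gt0.
have ex0 : exists K, (A * (2 ^ (K * d) - 1) <= n)%N by exists 0%N; rewrite muln0.
have bd K : (A * (2 ^ (K * d) - 1) <= n)%N -> (K <= n)%N.
  apply: leq_trans; apply: leq_trans (leq_pmull _ A0).
  rewrite leq_subRL ?expn_gt0 // add1n.
  by apply: leq_trans (ltn_expl K (isT : 1 < 2)%N) _; rewrite leq_exp2l // leq_pmulr.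
case: (ex_maxnP ex0 bd) => K hK maxK.
(* By maximality the cost of [K.+1] exceeds [n]. *)
have nK : n%:R <= A%:R * 2 `^ d%:R * 2 `^ (K%:R * d%:R) :> R.
  have : (n <= A * 2 ^ (K.+1 * d))%N.
    have : ~~ (A * (2 ^ (K.+1 * d) - 1) <= n)%N.
      by apply/negP => /maxK; rewrite ltnn.
    by rewrite -ltnNge => /ltnW/leq_trans; apply; rewrite leq_pmul2l // leq_subr.
  rewrite -(ler_nat R) natrM -[X in _ <= _ * X -> _]pow2_nat => h.
  by apply: (le_trans h); rewrite -mulrA -pow2D
    natrM -[K.+1%:R]natr1 mulrDl mul1r [X in _ <= _ * 2 `^ X]addrC.
apply: (killable_width (killable_widen p0 q0 hK (H K))) => a ab a1 /(_ ab a1)[h1 h2].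
apply: (@le_trans _ _ (((G / (1 - sg) * 2 `^ (- (2 * K%:R * t))) `^ 2^-1)%:E)%E).
  apply: bnorm22_le => N.
  apply: (@le_trans _ _ (\sum_(j < N) G * 2 `^ (- (2 * K%:R * t)) *
     (if (j < K)%N then 0 else sg ^+ (j - K)))).
    apply: ler_sum => j _; case: ltnP => jK; first by rewrite h1 // !mulr0.
    by have := h2 (j - K)%N; rewrite subnKC.
  rewrite -mulr_sumr [leRHS]mulrAC ler_wpM2l ?sum_shift_geom_le //.
  by rewrite mulr_ge0 ?powR_ge0 // ltW.
rewrite lee_fin powRM ?powR_ge0 //; last by rewrite divr_ge0 // ltW.
rewrite -/c -[leRHS]mulrA ler_wpM2l ?powR_ge0 // -powRrM.
have -> : - (2 * K%:R * t) * 2^-1 = K%:R * d%:R * - (t / d%:R).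
  by field; rewrite gt_eqF.
rewrite [X in X <= _]powRrM powRN [X in _ <= _ * X]powRN.
rewrite ler_pdivlMr ?powR_gt0 ?ltr0n // mulrC ler_pdivrMr ?powR_gt0 ?pow2_gt0 //.
have A2 : 0 <= A%:R * 2 `^ d%:R :> R by rewrite mulr_ge0 ?powR_ge0.
rewrite /M -(powRM (t / d%:R) A2 (powR_ge0 _ _)).
by apply: ge0_ler_powR; rewrite ?nnegrE // mulr_ge0 ?powR_ge0.
Qed.

(** All coordinates are killed; the sizes sum geometrically because [2 * 2^(K d) <= 2^(K.+1 d)]. *)
Lemma killable_levels K : killable nabla sF p q (D * (2 ^ (K * d) - 1))
  (fun a => forall j, (j < K)%N -> sumsq nabla a j = 0).
Proof.
apply: (@killable_widen _ _ _ _ _ _ p0 q0 (\sum_(j < K) size (nabla j))); last first.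
  apply: (killable_forall p0 q0 (Z := fun j a => sumsq nabla a j = 0)
    (m := fun j => size (nabla j))) => j _.
  exact: killable_level.
elim: K => [|K IH]; first by rewrite big_ord0.
rewrite big_ord_recr /=; apply: leq_trans (leq_add IH (size_nabla K)) _.
rewrite -mulnDr leq_pmul2l // -(leq_add2r 1) addnAC subnK ?expn_gt0 //.
rewrite subnK ?expn_gt0 // addnn -mul2n -expnS leq_exp2l // mulSn.
by rewrite -add1n leq_add2r.
Qed.

(** Used for [p > 2]: the weighted energy of level [j] already decays like [2^(- 2 j t)], so killing
    the levels below [K] is enough. *)
Lemma upper_of_l2_decay (s t B : R) : 0 < t -> 0 < B ->
  (forall a, in_b nabla sF p q a -> (bnorm nabla sF p q a <= 1)%E ->
     forall j, sumsq nabla a j <= B * 2 `^ (- (2 * (j%:R * (s + t))))) ->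
  exists2 c2 : R, 0 < c2 & forall n : nat, (0 < n)%N ->
    (gelfand_width nabla sF p q s 2%:E 2%:E n
       <= (c2 * n%:R `^ (- (t / d%:R)))%:E)%E.
Proof.
move=> t0 B0 H; apply: (@width_upper s t B (2 `^ (- (2 * t))) D) => //.
  by rewrite powR_ge0 pow2_lt1 // oppr_lt0 mulr_gt0.
move=> K; apply: killable_sub (killable_levels K) => a h ab a1; split=> // i.
apply: le_trans (ler_wpM2l (powR_ge0 _ _) (H a ab a1 (K + i)%N)) _.
rewrite mulrCA -[leRHS]mulrA ler_pM2l // pow2_exprn -!pow2D natrD.
by apply: pow2_le; rewrite le_eqVlt; apply/orP; left; apply/eqP; ring.
Qed.

Lemma sum_sqr_le (I : Type) (r : seq I) (f : I -> R) :
  \sum_(i <- r) f i ^+ 2 <= (\sum_(i <- r) `|f i|) ^+ 2.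
Proof.
elim: r => [|i r IH]; first by rewrite !big_nil expr0n.
rewrite !big_cons sqrrD real_normK ?num_real // addrAC -addrA lerD2l.
apply: (le_trans IH); rewrite lerDl mulrn_wge0 // mulr_ge0 //.
exact: sumr_ge0.
Qed.

(** [l1_l2_section] on level [K + i]: its size exceeds the number of functionals by a factor of
    order [2^((d + del) i)], whose logarithm gives [1 + i]. If the truncation is 0, the trivial
    bound of [l_2] by [l_1] suffices. *)
Lemma killable_l2_by_l1 (del : R) : 0 < del ->
  exists2 H : R, 0 < H & forall K i : nat,
    killable nabla sF p q
      (Num.truncn ((2 ^ (K * d) - 1)%N%:R * 2 `^ (- del * i%:R) : R))
      (fun a => sumsq nabla a (K + i) * (2 `^ (K%:R * d%:R) * 2 `^ (- del * i%:R))
         <= H * (1 + i%:R) * (\sum_(l <- nabla (K + i)) `|a (K + i)%N l|) ^+ 2).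
Proof.
move=> del0; have l2 : 0 < ln 2 :> R by rewrite ln_gt0 // ltr1n.
(* [kap] and, below, [c] keep large numerals opaque to the linear arithmetic. *)
have [kap kapE] : exists kap : R, D%:R = kap / 800.
  by exists (800 * D%:R); field.
(* Chosen so that [L = l0 + i * l1] gives [exp(- L) = 1 / (800 D 2^((d + del) i))]. *)
pose l0 : R := ln kap; pose l1 := (d%:R + del) * ln 2.
have kap800 : 800 <= kap.
  have : 1 <= D%:R :> R by rewrite ler1n.
  by rewrite kapE; lra.
have kap2 : 2 <= kap by lra.
have kap0 : 0 < kap by lra.
have [c c0 cE] : exists2 c : R, 0 < c & 6400 = c by exists 6400; rewrite ?ltr0n.
have l00 : 0 < l0 by rewrite ln_gt0 //; lra.
have l10 : 0 < l1 by rewrite mulr_gt0 // ltr_wpDl.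
have c4 : 0 < c * (4 * (l0 + l1)) by rewrite !mulr_gt0 // addr_gt0.
(* The summand 2 serves the case of no functional, where [y <= 2]; the other one serves the section
   estimate. *)
exists (2 + c * (4 * (l0 + l1))); first by rewrite addr_gt0.
move=> K i; set r := 2 `^ (- del * i%:R); set x : R := _ * r.
have r0 : 0 < r by exact: pow2_gt0.
have r1 : r <= 1 by rewrite pow2_le1 // mulNr oppr_le0 mulr_ge0 // ltW.
have x0 : 0 <= x by rewrite mulr_ge0 // ltW.
set y := 2 `^ (K%:R * d%:R) * r.
have y0 : 0 < y by rewrite mulr_gt0 // pow2_gt0.
have xy : y <= x + r by rewrite /x /y pow2_natM natrB ?expn_gt0 // mulrBl mul1r subrK.
have i0 : 0 <= i%:R :> R by [].
have Hi : 2 <= (2 + c * (4 * (l0 + l1))) * (1 + i%:R) by nra.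
have /andP[hn1 hn2] := truncn_itv x0.
have [n0|np] := posnP (Num.truncn x).
  rewrite n0; apply: killable_sub (killableT nabla sF p0 q0 0) => a _.
  have y2 : y <= 2 by rewrite n0 in hn2; lra.
  set S := \sum_(_ <- _) _; have SS : sumsq nabla a (K + i) <= S ^+ 2 by exact: sum_sqr_le.
  have := sumsq_ge0 nabla a (K + i); have := sqr_ge0 S => S0 s0.
  apply: (@le_trans _ _ (S ^+ 2 * 2)).
    by apply: ler_pM => //; exact: ltW.
  by rewrite mulrC ler_wpM2r.
set n := Num.truncn x in hn1 hn2 np *.
have n1 : 1 <= n%:R :> R by rewrite ler1n.
(* [y <= x + r <= 2 x < 2 (n + 1) <= 4 n]. *)
have yn : y <= 4 * n%:R.
  have xr : r <= x.
    rewrite /x -[leLHS]mul1r ler_wpM2r // ?(ltW r0) // ler1n.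
    rewrite lt0n; apply/eqP => e0; move: hn1; rewrite /x e0 mul0r; lra.
  by rewrite -natr1 in hn2; lra.
pose L := l0 + i%:R * l1; have L0 : 0 < L by rewrite ltr_wpDr // mulr_ge0 // ltW.
pose I := 'I_(size (nabla (K + i))).
have eL : expR (- L) = kap^-1 * (2 `^ (- (i%:R * d%:R)) * r).
  rewrite /L opprD expRD expRN lnK ?posrE //.
  congr (_ * _); rewrite /r -pow2D /powR pnatr_eq0 /= /l1; congr expR; ring.
have tm : expR (- L) * #|{: I}|%:R <= n%:R / 200.
  rewrite card_ord; apply: (@le_trans _ _ (y / 800)); last by lra.
  apply: (@le_trans _ _ (expR (- L) * (D%:R * 2 `^ ((K + i)%:R * d%:R)))).
    by rewrite ler_wpM2l ?expR_ge0 // pow2_natM -natrM ler_nat.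
  have -> : 2 `^ ((K + i)%:R * d%:R) = 2 `^ (K%:R * d%:R) * 2 `^ (i%:R * d%:R) :> R.
    by rewrite -pow2D -mulrDl -natrD.
  rewrite kapE eL /y powRN le_eqVlt; apply/orP; left; apply/eqP; field.
  by rewrite !gt_eqF ?pow2_gt0.
have t1 : expR (- L) <= 2^-1.
  rewrite eL -[leRHS]mulr1; apply: ler_pM.
  - by rewrite invr_ge0 ltW.
  - by rewrite mulr_ge0 ?powR_ge0 // ltW.
  - by rewrite lef_pV2 ?posrE // ltr0n.
  - apply: mulr_ile1; rewrite ?powR_ge0 ?(ltW r0) //.
    by rewrite pow2_le1 // oppr_le0 mulr_ge0.
pose Q := n%:R / (c * L).
have Q0 : 0 < Q by rewrite divr_gt0 ?mulr_gt0 // (lt_le_trans ltr01).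
have QL : 6400 * Q * L <= n%:R.
  by rewrite cE le_eqVlt; apply/orP; left; apply/eqP; rewrite /Q; field; rewrite !gt_eqF.
have [e _ He] := l1_l2_section np t1 tm (ltW L0) (ltW Q0) QL.
(* The signs, indexed by positions in the list, are carried over to the indices [l]. *)
pose ee k l := \sum_(u : I) (l == tnth (in_tuple (nabla (K + i))) u)%:R * e k u.
apply: killable_sub (killable_rows nabla sF p0 q0 (K + i) n ee) => a ha.
have := He (fun u => a (K + i)%N (tnth (in_tuple (nabla (K + i))) u)).
rewrite -(big_tnth _ _ _ xpredT (fun l => a (K + i)%N l ^+ 2)).
rewrite -(big_tnth _ _ _ xpredT (fun l => `|a (K + i)%N l|)).
have kill k : (k < n)%N ->
    \sum_(u : I) e k u * a (K + i)%N (tnth (in_tuple (nabla (K + i))) u) = 0.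
  move=> kn; rewrite -[RHS](ha k kn) [RHS]big_tnth; apply: eq_bigr => u _; congr (_ * _).
  rewrite /ee (bigD1 u) //= eqxx mul1r big1 ?addr0 // => v vu.
  rewrite (_ : _ == _ = false) ?mul0r //; apply/negbTE; apply: contra vu => /eqP h.
  have : uniq (in_tuple (nabla (K + i))) by exact: uniq_nabla.
  by move/tuple_uniqP => inj; rewrite (inj _ _ h).
move=> /(_ kill); rewrite -/(sumsq nabla a (K + i)).
set S := \sum_(_ <- _) _; have := sumsq_ge0 nabla a (K + i).
set E := sumsq _ _ _ => E0 h.
have h1 : n%:R * E <= c * L * S ^+ 2.
  have -> : n%:R * E = c * L * (Q * E).
    by rewrite /Q; field; rewrite !gt_eqF.
  by rewrite ler_pM2l // mulr_gt0.
apply: (@le_trans _ _ (c * (4 * L) * S ^+ 2)).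
  apply: (@le_trans _ _ (E * (4 * n%:R))); first by rewrite ler_wpM2l.
  by clear QL cE tm kap800 kapE; lra.
rewrite ler_wpM2r ?sqr_ge0 // /L.
have : 0 <= c * (4 * l0) * i%:R.
  exact: mulr_ge0 (mulr_ge0 (ltW c0) (mulr_ge0 (ler0n _ 4) (ltW l00))) i0.
have : 0 <= c * (4 * l1) by exact: mulr_ge0 (ltW c0) (mulr_ge0 (ler0n _ 4) (ltW l10)).
clear QL cE tm kap800 kapE; lra.
Qed.

(** Used for [p < 2], with [del = t - d / 2]. The [l_1] decay squared gives [2^(- 2 del i)], the
    section estimate loses [2^(del i) (1 + i)], and half of the remaining [2^(- del i)] absorbs
    [1 + i]. *)
Lemma upper_of_l1_decay (s t B : R) : d%:R / 2 < t -> 0 < B ->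
  (forall a, in_b nabla sF p q a -> (bnorm nabla sF p q a <= 1)%E ->
     forall j, \sum_(l <- nabla j) `|a j l| <= B * 2 `^ (- (j%:R * (s + t - d%:R / 2)))) ->
  exists2 c2 : R, 0 < c2 & forall n : nat, (0 < n)%N ->
    (gelfand_width nabla sF p q s 2%:E 2%:E n
       <= (c2 * n%:R `^ (- (t / d%:R)))%:E)%E.
Proof.
move=> td B0 hB; pose del := t - d%:R / 2.
have del0 : 0 < del by rewrite subr_gt0.
have t0 : 0 < t by apply: le_lt_trans td; rewrite divr_ge0.
have [H H0 HK] := killable_l2_by_l1 del0.
have [C C0 HC] := natS_le_pow2 (divr_gt0 del0 (ltr0n R 2)).
have rho1 : 0 <= (2 : R) `^ (- del) < 1 by rewrite powR_ge0 pow2_lt1 // oppr_lt0.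
(* Bounds the geometric sum of the numbers of functionals on the levels [K + i]. *)
pose A := (Num.truncn (1 - 2 `^ (- del))^-1 : nat).+1.
apply: (@width_upper s t (H * B ^+ 2 * C) (2 `^ (- (del / 2))) (D + A)) => //.
- by rewrite !mulr_gt0 // exprn_gt0.
- by rewrite powR_ge0 pow2_lt1 // oppr_lt0 divr_gt0.
- by rewrite addnS.
move=> K; pose x i : R := (2 ^ (K * d) - 1)%N%:R * 2 `^ (- del * i%:R).
(* From this index on [x i < 1], so its truncation is 0 and only finitely many levels cost
   anything. *)
pose N := (Num.truncn (K%:R * d%:R / del)).+1.
have xN i : (N <= i)%N -> Num.truncn (x i) = 0%N.
  have x0 : 0 <= x i by rewrite mulr_ge0 ?powR_ge0.
  move=> Ni; apply/eqP; rewrite truncn_eq // x0 /=.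
  apply: (@le_lt_trans _ _ (2 `^ (K%:R * d%:R) * 2 `^ (- del * i%:R))).
    by rewrite ler_wpM2r ?powR_ge0 // pow2_natM ler_nat leq_subr.
  rewrite -pow2D pow2_lt1 // mulNr subr_lt0 -ltr_pdivrMl // mulrC.
  apply: (@lt_le_trans _ _ N%:R); last by rewrite ler_nat.
  by have /andP[] := truncn_itv (divr_ge0 (mulr_ge0 (ler0n R K) (ler0n R d)) (ltW del0)).
have xA : (\sum_(i < N) Num.truncn (x i) <= A * (2 ^ (K * d) - 1))%N.
  rewrite -(ler_nat R) natr_sum natrM.
  apply: (@le_trans _ _ (\sum_(i < N) x i)).
    by apply: ler_sum => i _; rewrite truncn_le mulr_ge0 ?powR_ge0.
  rewrite -mulr_sumr mulrC ler_wpM2r //.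
  under eq_bigr do rewrite -pow2_exprn.
  apply: (le_trans (sum_geom_le N rho1)).
  have inv0 : 0 <= (1 - 2 `^ (- del))^-1 :> R.
    by rewrite invr_ge0 subr_ge0 ltW //; case/andP: rho1.
  by rewrite ltW //; have /andP[] := truncn_itv inv0.
have HKN := killable_forall p0 q0 (fun i (_ : (i < N)%N) => HK K i).
have := killable_and (killable_levels K) (killable_widen p0 q0 xA HKN).
rewrite -mulnDl; apply: killable_sub => a [ha1 ha2] ab a1; split=> // i.
have {ha2} ha i' : sumsq nabla a (K + i') * (2 `^ (K%:R * d%:R) * 2 `^ (- del * i'%:R))
    <= H * (1 + i'%:R) * (\sum_(l <- nabla (K + i')) `|a (K + i')%N l|) ^+ 2.
  (* From [N] on, [killable] with [m = 0] gives the estimate for every sequence. *)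
  have [iN|iN] := ltnP i' N; first exact: ha2.
  have := HK K i'; rewrite -/(x i') (xN _ iN) => -[Ls _ Hs].
  by apply: Hs => -[].
have := ha i; set E := sumsq _ _ _; set S := \sum_(_ <- _) _ => hE.
have S0 : 0 <= S by exact: sumr_ge0.
pose w := 2 `^ (K%:R * d%:R) * 2 `^ (- del * i%:R) : R.
have w0 : 0 < w by rewrite mulr_gt0 ?pow2_gt0.
have hS : S ^+ 2 <= B ^+ 2 * 2 `^ (- (2 * ((K + i)%:R * (s + t - d%:R / 2)))).
  have -> : - (2 * ((K + i)%:R * (s + t - d%:R / 2)))
    = - ((K + i)%:R * (s + t - d%:R / 2)) * 2%:R by ring.
  rewrite -pow2_exprn -exprMn lerXn2r ?nnegrE ?mulr_ge0 ?powR_ge0 ?(ltW B0) //.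
  exact: hB.
rewrite -(ler_pM2r w0) -[leLHS]mulrA.
apply: (le_trans (ler_wpM2l (powR_ge0 _ _) hE)).
apply: (@le_trans _ _ (2 `^ (2 * ((K + i)%:R * s)) * (H * (C * 2 `^ (del / 2 * i%:R)) *
   (B ^+ 2 * 2 `^ (- (2 * ((K + i)%:R * (s + t - d%:R / 2)))))))).
  apply: ler_wpM2l; first exact: powR_ge0.
  apply: ler_pM; rewrite ?sqr_ge0 //.
    by rewrite mulr_ge0 ?addr_ge0 // ltW.
  by rewrite ler_pM2l.
rewrite [leLHS](_ : _ = H * B ^+ 2 * C * (2 `^ (2 * ((K + i)%:R * s)) *
   2 `^ (del / 2 * i%:R) * 2 `^ (- (2 * ((K + i)%:R * (s + t - d%:R / 2)))))); last by ring.
rewrite -[_ * _ * _ ^+ i * w]mulrA -[_ * _ * (_ ^+ i * w)]mulrA.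
have G0 : 0 < H * B ^+ 2 * C by rewrite !mulr_gt0 // exprn_gt0.
rewrite (ler_pM2l G0).
rewrite pow2_exprn /w -!pow2D natrD.
by apply: pow2_le; rewrite le_eqVlt; apply/orP; left; apply/eqP; rewrite /del; field.
Qed.

End Upper.

(** * Lower bounds for Gelfand widths *)

Lemma admissible_size (R : realType) (d : nat) (nabla : nat -> seq (Lam d)) :
  admissible_nabla R nabla ->
  exists D E J : nat, [/\ (0 < D)%N, (0 < E)%N,
    forall j, (size (nabla j) <= D * 2 ^ (j * d))%N &
    forall j, (J <= j)%N -> (2 ^ (j * d) <= E * size (nabla j))%N].
Proof.
move=> [_ [_ [C1 [C2 [J [C10 [C12 H]]]]]]].
have {}H j : (J <= j)%N -> C1 * (2 ^ (j * d))%:R <= (size (nabla j))%:R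
    <= C2 * (2 ^ (j * d))%:R.
  move=> /H; rewrite powRN pow2_natM.
  have P0 : 0 < (2 ^ (j * d))%:R :> R by rewrite ltr0n expn_gt0.
  by rewrite mulrC ler_pdivlMr // ler_pdivrMr.
have C20 : 0 < C2 by exact: lt_le_trans C12.
(* The sum takes care of the finitely many levels below [J]. *)
pose D := ((Num.truncn C2).+1 + \sum_(j < J) size (nabla j))%N.
exists D, (Num.truncn C1^-1).+1, J; split => // j.
  have [Jj|jJ] := leqP J j.
    rewrite -(ler_nat R) natrM; have /andP[_ h] := H j Jj.
    apply: (le_trans h); rewrite ler_wpM2r //.
    apply: (@le_trans _ _ (Num.truncn C2).+1%:R); last by rewrite ler_nat leq_addr.
    by have /andP[_ /ltW] := truncn_itv (ltW C20).
  apply: (@leq_trans D); last by rewrite leq_pmulr ?expn_gt0.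
  by rewrite /D (bigD1 (Ordinal jJ)) //= addnCA leq_addr.
move=> Jj; have /andP[h _] := H j Jj.
rewrite -(ler_nat R) natrM; apply: (@le_trans _ _ (C1^-1 * (size (nabla j))%:R)).
  by rewrite ler_pdivlMl.
rewrite ler_wpM2r //.
have i0 : 0 <= C1^-1 by rewrite invr_ge0 ltW.
by have /andP[_ /ltW] := truncn_itv i0.
Qed.

(** The first suitable level from [J] on is taken: either it is [J], of bounded size, or its
    predecessor was too small. With [E] from [admissible_size] it has at least [2 n] indices. *)
Lemma choose_level (d E J : nat) : (0 < d)%N -> (0 < E)%N ->
  exists2 C : nat, (0 < C)%N & forall n, (0 < n)%N ->
    exists2 j, (J <= j)%N & (2 * n * E <= 2 ^ (j * d) <= C * n)%N.
Proof.
move=> d0 E0; exists (2 ^ (J * d) + 2 ^ d * (2 * E))%N.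
  by rewrite addn_gt0 expn_gt0.
move=> n n0.
have ex0 : exists l, (2 * n * E <= 2 ^ ((J + l) * d))%N.
  exists (2 * n * E)%N; apply: ltnW; apply: leq_trans (ltn_expl _ (isT : 1 < 2)%N) _.
  by rewrite leq_exp2l // (leq_trans (leq_addl J _)) // leq_pmulr.
case: (ex_minnP ex0) => l hl minl; exists (J + l)%N; first exact: leq_addr.
rewrite hl /=; case: l hl minl => [|l] hl minl.
  by rewrite addn0 mulnDl; apply: leq_trans (leq_addr _ _); rewrite leq_pmulr.
have : ~~ (2 * n * E <= 2 ^ ((J + l) * d))%N.
  by apply/negP => /minl; rewrite ltnn.
rewrite -ltnNge => /ltnW h; rewrite addnS mulSn expnD [X in (_ <= X)%N]mulnDl.
apply: leq_trans (leq_addl _ _); rewrite -mulnA leq_pmul2l ?expn_gt0 //.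
by rewrite mulnAC.
Qed.

(** * Sequences supported on one level *)

Section Lower.
Variables (R : realType) (d : nat) (nabla : nat -> seq (Lam d)).
Variables (s : R) (p q : \bar R).
Hypotheses (p0 : (0 < p)%E) (q0 : (0 < q)%E).

Lemma in_b_level j (a : seqT R d) :
  (forall k l, a k l != 0 -> k = j /\ l \in nabla j) -> in_b nabla s p q a.
Proof.
move=> ha; split; first by move=> k l /ha [-> lj].
apply: le_lt_trans (bnorm_single s _ _) (ltry _) => // k kj.
apply: lp_level0 => // l; apply/eqP; apply: contraNT kj => /ha[-> _] //.
Qed.

Definition level_seq j (y : 'I_(size (nabla j)) -> R) : seqT R d :=
  fun k l => (k == j)%:R * \sum_i y i * (l == tnth (in_tuple (nabla j)) i)%:R.

Lemma level_seq_supp j y k l : @level_seq j y k l != 0 -> k = j /\ l \in nabla j.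
Proof.
rewrite /level_seq; have [-> h|_] := eqVneq k j; last by rewrite mul0r eqxx.
split=> //; apply: contraR h => lj; rewrite big1 ?mulr0 // => i _.
case: eqP => [e|]; last by rewrite mulr0.
by case/negP: lj; rewrite e mem_tnth.
Qed.

Lemma level_seq_in_b j y : in_b nabla s p q (@level_seq j y).
Proof. by apply: in_b_level => k l; exact: level_seq_supp. Qed.

Lemma level_seq_tnth j y i : uniq (nabla j) ->
  @level_seq j y j (tnth (in_tuple (nabla j)) i) = y i.
Proof.
move=> uj; rewrite /level_seq eqxx mul1r (bigD1 i) //= eqxx mulr1 big1 ?addr0 //.
move=> k ki; rewrite (_ : _ == _ = false) ?mulr0 //.
have /tuple_uniqP inj : uniq (in_tuple (nabla j)) by exact: uj.
by apply/negbTE; apply: contra ki => /eqP /inj ->.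
Qed.

(** Restricts a functional to a matrix column. Linearity is only known inside the space, so it is
    applied to partial sums that stay on level [j]. *)
Lemma functional_level_seq (L : seqT R d -> R) j y :
  cont_lin_functional nabla s p q L ->
  L (@level_seq j y) = \sum_i y i * L (level_seq (fun k => (k == i)%:R)).
Proof.
move=> [LD [LZ _]].
have L0 : L (@level_seq j (fun=> 0)) = 0.
  pose z : 'I_(size (nabla j)) -> R := fun=> 0.
  rewrite -[RHS](mul0r (L (level_seq z))) -(LZ 0 _ (level_seq_in_b z)); congr L.
  apply/funext => k; apply/funext => l; rewrite [RHS]mul0r /level_seq big1 ?mulr0 //.
  by move=> i _; rewrite mul0r.
have H (r : seq 'I_(size (nabla j))) :
    L (level_seq (fun i => \sum_(k <- r) y k * (i == k)%:R))
    = \sum_(i <- r) y i * L (level_seq (fun k => (k == i)%:R)).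
  elim: r => [|i r IH].
    by rewrite big_nil -L0; congr (L (level_seq _)); apply/funext => i; rewrite big_nil.
  rewrite big_cons -IH -(LZ _ _ (level_seq_in_b (fun k => (k == i)%:R))) -LD; last first.
  - exact: level_seq_in_b.
  - apply: in_b_level => k l h; apply: (@level_seq_supp j (fun k => (k == i)%:R)).
    by apply: contra h => /eqP ->; rewrite mulr0.
  congr L; apply/funext => k; apply/funext => l.
  rewrite /level_seq mulrCA -mulrDr [y i * _]mulr_sumr -big_split /=; congr (_ * _).
  by apply: eq_bigr => u _; rewrite big_cons mulrDl mulrA.
rewrite -H; congr (L (level_seq _)); apply/funext => i.
rewrite (bigD1 i) //= eqxx mulr1 big1 ?addr0 // => k ki.
by rewrite eq_sym (negPf ki) mulr0.
Qed.

End Lower.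

(** The test sequence is a cube vertex of the common kernel on a level with [m >= 2 n] indices,
    scaled into the unit ball: at least [m / 2] of its entries have the maximal modulus [k]. *)
Lemma gelfand_width_ge (R : realType) (d : nat) (nabla : nat -> seq (Lam d))
    (s t : R) (p q : \bar R) :
  (0 < d)%N -> admissible_nabla R nabla ->
  (0 < p)%E -> (0 < q)%E -> 0 < t ->
  exists2 c1 : R, 0 < c1 & forall n : nat, (0 < n)%N ->
    ((c1 * n%:R `^ (- (t / d%:R)))%:E
       <= gelfand_width nabla (s + t) p q s 2%:E 2%:E n)%E.
Proof.
move=> d0 adm p0 q0 t0; have [unabla _] := adm.
have [D [E [J [D0 E0 hD hE]]]] := admissible_size adm.
have [C C0 HC] := choose_level J d0 E0.
set v := invp p; have v0 : 0 <= v.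
  by rewrite /v; case: (p) p0 => //= r; rewrite lte_fin invr_ge0 => /ltW.
have dp : 0 < d%:R :> R by rewrite ltr0n.
have td0 : 0 <= t / d%:R by rewrite ltW // divr_gt0.
have Dp : 0 < D%:R :> R by rewrite ltr0n.
have Ep : 0 < (2 * E%:R)^-1 :> R by rewrite invr_gt0 mulr_gt0 ?ltr0n.
have Cp : 0 < C%:R :> R by rewrite ltr0n.
(* The factors come from [m / 2 >= 2^(j d) / (2 E)], [m <= D 2^(j d)] and [2^(j d) <= C n]. *)
pose c1 : R := (2 * E%:R)^-1 `^ 2^-1 * D%:R `^ (- v) * C%:R `^ (- (t / d%:R)).
exists c1; first by rewrite !mulr_gt0 ?powR_gt0.
move=> n n0; have [j Jj /andP[hj1 hj2]] := HC n n0.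
apply: le_ereal_inf_tmp => _ [Ls [cL ->]].
pose m := size (nabla j).
have P0 : 0 < (2 ^ (j * d))%:R :> R by rewrite ltr0n expn_gt0.
have nm : (2 * n <= m)%N.
  by have := leq_trans hj1 (hE j Jj); rewrite [(E * _)%N]mulnC leq_pmul2r.
have mp : 0 < m%:R :> R.
  by rewrite ltr0n; apply: leq_trans nm; rewrite muln_gt0.
pose B : 'M[R]_(m, n) :=
  \matrix_(i, k) Ls k (@level_seq R d nabla j (fun u => (u == i)%:R)).
have [x xB [x1 xm]] := cube_section_vertex B.
pose w : R := 2 `^ (j%:R * (s + t + d%:R * (2^-1 - v))).
have w0 : 0 < w by exact: pow2_gt0.
pose k := (w * m%:R `^ v)^-1.
have k0 : 0 < k by rewrite invr_gt0 mulr_gt0 // powR_gt0.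
pose a := @level_seq R d nabla j (fun i => k * x 0 i).
have ab : in_b nabla (s + t) p q a by exact: level_seq_in_b.
have ale l : `|a j l| <= k.
  have [->|/level_seq_supp[_ lj]] := eqVneq (a j l) 0; first by rewrite normr0 ltW.
  have /tnthP[i ->] : l \in in_tuple (nabla j) by [].
  rewrite /a level_seq_tnth // normrM gtr0_norm // -[leRHS]mulr1.
  by rewrite ler_wpM2l // ltW.
apply: le_trans (ereal_sup_ubound _); last first.
  exists a; split; [exact: ab| | |reflexivity].
    apply: le_trans (bnorm_single (j := j) _ _ _) _ => //.
      move=> u uj; apply: lp_level0 => // l; apply/eqP.
      by apply: contraNT uj => /level_seq_supp[-> _].
    rewrite lee_fin /bterm -/v -/w.
    apply: le_trans (ler_wpM2l (ltW w0) (lp_level_le nabla p0 (ltW k0) ale)) _.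
    by rewrite mulrCA -/v -/m mulVf // gt_eqF // mulr_gt0 // powR_gt0.
  move=> i; rewrite (functional_level_seq p0 q0 _ (cL i)).
  have /matrixP/(_ 0 i) := xB; rewrite !mxE => h.
  under eq_bigr do rewrite -mulrA.
  rewrite -mulr_sumr -[RHS](mulr0 k) -[in RHS]h; congr (_ * _).
  by apply: eq_bigr => u _; rewrite mxE.
have q2 : (0 < (2 : R)%:E)%E by rewrite lte_fin.
apply: le_trans (bterm_le_bnorm nabla s 2%:E a j q2).
rewrite lee_fin bterm2E.
have hsq : k ^+ 2 * (m%:R / 2) <= sumsq nabla a j.
  rewrite /sumsq /a big_tnth.
  under eq_bigr do rewrite level_seq_tnth // exprMn.
  rewrite -mulr_sumr ler_pM2l ?exprn_gt0 //.
  rewrite (bigID (fun i => `|x 0 i| == 1)) /=.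
  apply: (@le_trans _ _ (\sum_(i | `|x 0 i| == 1) x 0 i ^+ 2)); last first.
    by rewrite lerDl sumr_ge0 // => i _; exact: sqr_ge0.
  rewrite (eq_bigr (fun=> 1)) => [|i /eqP e]; last first.
    by rewrite -real_normK ?num_real // e expr1n.
  rewrite sumr_const.
  apply: (@le_trans _ _ (m - n)%N%:R); last first.
    by rewrite ler_nat; apply: leq_trans xm _; rewrite cardsE.
  rewrite natrB; last by apply: leq_trans nm; rewrite leq_pmull.
  by move: nm; rewrite -(ler_nat R) natrM; lra.
have mP : (2 ^ (j * d))%:R * (2 * E%:R)^-1 <= m%:R / 2 :> R.
  have := hE j Jj; rewrite -/m -(ler_nat R) natrM => h.
  rewrite ler_pdivrMr ?mulr_gt0 ?ltr0n //.
  by rewrite (_ : m%:R / 2 * _ = E%:R * m%:R) //; field.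
apply: (@le_trans _ _ (2 `^ (j%:R * s)
    * (k * ((2 ^ (j * d))%:R * (2 * E%:R)^-1) `^ 2^-1))); last first.
  rewrite ler_wpM2l ?powR_ge0 //.
  have -> : k = (k ^+ 2) `^ 2^-1.
    by rewrite -powR_mulrn ?(ltW k0) // -powRrM mulfV // powRr1 // ltW.
  have z0 := mulr_ge0 (ltW P0) (ltW Ep).
  rewrite -(powRM _ (sqr_ge0 k) z0).
  apply: ge0_ler_powR; rewrite ?invr_ge0 ?nnegrE ?sumsq_ge0 //.
    exact: mulr_ge0 (sqr_ge0 _) z0.
  by apply: le_trans hsq; rewrite ler_wpM2l ?sqr_ge0.
rewrite powRM ?(ltW P0) ?(ltW Ep) //.
set P : R := (2 ^ (j * d))%:R in P0 hj2 *; set E2 := (2 * E%:R)^-1 `^ 2^-1.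
(* All exponents of [w] become powers of [P = 2^(j d)], so that only [P^(t / d)] and the ratio of
   [m^v] to [P^v] survive. *)
have wE : w = 2 `^ (j%:R * s) * P `^ (t / d%:R) * P `^ 2^-1 * (P `^ v)^-1.
  rewrite /P -pow2_natM -powRN -!powRrM -!pow2D; congr (2 `^ _); field.
  by rewrite gt_eqF.
have E20 : 0 < E2 by exact: powR_gt0.
have hM : m%:R `^ v <= D%:R `^ v * P `^ v.
  rewrite -powRM ?(ltW P0) ?(ltW Dp) //.
  apply: ge0_ler_powR; rewrite ?nnegrE ?mulr_ge0 ?(ltW P0) //.
  rewrite /P -natrM ler_nat; exact: hD.
have hP : P `^ (t / d%:R) <= C%:R `^ (t / d%:R) * n%:R `^ (t / d%:R).
  rewrite -powRM // -natrM; apply: ge0_ler_powR; rewrite ?nnegrE ?(ltW P0) //.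
  by rewrite /P ler_nat.
rewrite /c1 /k wE !powRN -/E2.
have x10 : 0 < 2 `^ (j%:R * s) :> R by exact: pow2_gt0.
have x20 : 0 < P `^ 2^-1 by exact: powR_gt0.
have x30 : 0 < P `^ v by exact: powR_gt0.
have y0 : 0 < P `^ (t / d%:R) by exact: powR_gt0.
have M0 : 0 < m%:R `^ v by exact: powR_gt0.
have nn0 : 0 < n%:R `^ (t / d%:R) :> R by rewrite powR_gt0 // ltr0n.
have D0' : 0 < D%:R `^ v :> R by exact: powR_gt0.
have C0' : 0 < C%:R `^ (t / d%:R) :> R by exact: powR_gt0.
move: x10 x20 x30 y0 M0 nn0 D0' C0' hM hP.
set z1 := 2 `^ _; set x2 := P `^ 2^-1; set x3 := P `^ v; set y := P `^ _.
set M := m%:R `^ v; set nn := n%:R `^ _; set Dv := D%:R `^ v; set Ct := C%:R `^ _.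
move=> x10 x20 x30 y0 M0 nn0 Dv0 Ct0 hM hP.
rewrite [leLHS](_ : _ = E2 * ((Ct * nn) * Dv)^-1); last by field; rewrite !gt_eqF.
rewrite [leRHS](_ : _ = E2 * (y * (M / x3))^-1); last by field; rewrite !gt_eqF.
rewrite ler_pM2l // lef_pV2 ?posrE ?mulr_gt0 ?invr_gt0 //.
by apply: ler_pM; rewrite ?(ltW y0) ?divr_ge0 ?(ltW M0) ?(ltW x30) // ler_pdivrMr.
Qed.

(** * Unit balls of the sequence spaces *)

Section Embeddings.
Variables (R : realType) (d : nat) (nabla : nat -> seq (Lam d)) (D : nat).
Hypothesis size_nabla : forall j, (size (nabla j) <= D * 2 ^ (j * d))%N.
Implicit Types (a : seqT R d) (p q : \bar R) (s : R).

Lemma lp_level_unit_ball s p q a j : (0 < q)%E -> (bnorm nabla s p q a <= 1)%E ->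
  lp_level nabla p a j <= 2 `^ (- (j%:R * (s + d%:R * (2^-1 - invp p)))).
Proof.
move=> q0 a1; have := le_trans (bterm_le_bnorm nabla s p a j q0) a1.
by rewrite lee_fin /bterm powRN -ler_pdivlMl ?pow2_gt0 // mulr1.
Qed.

Lemma size_nabla_powR j (r : R) : 0 <= r ->
  (size (nabla j))%:R `^ r <= D%:R `^ r * 2 `^ (j%:R * d%:R * r).
Proof.
move=> r0; rewrite powRrM -powRM ?powR_ge0 //.
apply: ge0_ler_powR; rewrite ?nnegrE ?mulr_ge0 ?powR_ge0 //.
by rewrite pow2_natM -natrM ler_nat.
Qed.

(** The power mean inequality with exponent [p / 2] for the squares; for [p = +oo] every square is
    at most the squared maximum. *)
Lemma sumsq_le_lp p a j : (2%:E < p)%E ->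
  sumsq nabla a j
    <= (size (nabla j))%:R `^ (1 - 2 * invp p) * lp_level nabla p a j ^+ 2.
Proof.
case: p => [r| |] // r2.
  have {}r2 : 2 < r by rewrite lte_fin in r2.
  have r0 : 0 < r by apply: lt_trans r2.
  have rho1 : 1 <= r / 2 by lra.
  have f0 l : 0 <= `|a j l| ^+ 2 by exact: sqr_ge0.
  have := sum_le_power_mean (nabla j) rho1 f0.
  rewrite (eq_bigr (fun l => a j l ^+ 2)) => [|l _]; last by rewrite real_normK ?num_real.
  rewrite -/(sumsq nabla a j) invf_div.
  rewrite (eq_bigr (fun l => `|a j l| `^ r)) => [|l _]; last first.
    by rewrite -powR_mulrn // -powRrM; congr (_ `^ _); field.
  by rewrite [2 / r]mulrC powRrM powR_mulrn ?powR_ge0 // [2 * _]mulrC.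
rewrite [invp _]/= mulr0 subr0 powRr1 //.
set M := lp_level _ _ _ _; have pinf : (0 < +oo :> \bar R)%E by [].
apply: (@le_trans _ _ (\sum_(l <- nabla j) M ^+ 2)).
  rewrite /sumsq big_seq [leRHS]big_seq; apply: ler_sum => l lj.
  rewrite -[leLHS]real_normK ?num_real // lerXn2r ?nnegrE ?lp_level_ge0 //.
  exact: coord_le_lp.
by rewrite big_const_seq count_predT iter_addr_0 -[M ^+ 2 *+ _]mulr_natl.
Qed.

(** The embedding into [l_1] costs [2^(j d (1 - 1/p))], which cancels the [p] in the weight. *)
Lemma l1_unit_ball_ge1 (s t p : R) q a j : 1 <= p -> (0 < q)%E ->
  (bnorm nabla (s + t) p%:E q a <= 1)%E ->
  \sum_(l <- nabla j) `|a j l|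
    <= D%:R `^ (1 - p^-1) * 2 `^ (- (j%:R * (s + t - d%:R / 2))).
Proof.
move=> p1 q0 /(lp_level_unit_ball j q0) /= ha.
have p0 : 0 < p by apply: lt_le_trans p1.
have pi0 : 0 <= 1 - p^-1 by rewrite subr_ge0 invf_le1.
apply: le_trans (sum_le_power_mean (nabla j) p1 (fun l => normr_ge0 (a j l))) _.
apply: le_trans (ler_pM (powR_ge0 _ _) (powR_ge0 _ _) (size_nabla_powR j pi0) ha) _.
rewrite -[leLHS]mulrA -pow2D ler_wpM2l ?powR_ge0 // pow2_le // le_eqVlt.
by apply/orP; left; apply/eqP; field; rewrite gt_eqF.
Qed.

(** The embedding of [l_p] into [l_1] has constant 1 here, so the [p] in the weight remains as a
    smoothness [t + d - d / p] in place of [t]. *)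
Lemma l1_unit_ball_lt1 (s t p : R) q a j : 0 < p -> p < 1 -> (0 < q)%E ->
  (bnorm nabla (s + t) p%:E q a <= 1)%E ->
  \sum_(l <- nabla j) `|a j l|
    <= 1 * 2 `^ (- (j%:R * (s + (t + d%:R - d%:R / p) - d%:R / 2))).
Proof.
move=> p0 p1 q0 /(lp_level_unit_ball j q0) /= ha.
apply: le_trans (sum_le_lp (nabla j) p0 (ltW p1) (fun l => normr_ge0 (a j l))) _.
apply: (le_trans ha); rewrite mul1r pow2_le // le_eqVlt.
by apply/orP; left; apply/eqP; field; rewrite gt_eqF.
Qed.

Lemma l2_unit_ball (s t : R) p q a j : (2%:E < p)%E -> (0 < q)%E ->
  (bnorm nabla (s + t) p q a <= 1)%E ->
  sumsq nabla a j
    <= D%:R `^ (1 - 2 * invp p) * 2 `^ (- (2 * (j%:R * (s + t)))).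
Proof.
move=> p2 q0 /(lp_level_unit_ball j q0) ha.
have pi0 : 0 <= 1 - 2 * invp p.
  case: (p) p2 => [r| |] /= p2; rewrite ?mulr0 ?subr0 //.
  rewrite lte_fin in p2; have r0 : 0 < r by apply: lt_trans p2.
  by rewrite subr_ge0 ler_pdivrMr // mul1r ltW.
apply: le_trans (sumsq_le_lp a j p2) _.
have ha2 : lp_level nabla p a j ^+ 2 <=
    2 `^ (- (j%:R * (s + t + d%:R * (2^-1 - invp p))) * 2%:R).
  by rewrite -pow2_exprn lerXn2r ?nnegrE ?lp_level_ge0 ?powR_ge0.
apply: le_trans (ler_pM (powR_ge0 _ _) (sqr_ge0 _) (size_nabla_powR j pi0) ha2) _.
rewrite -[leLHS]mulrA -pow2D ler_wpM2l ?powR_ge0 // pow2_le // le_eqVlt.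
by apply/orP; left; apply/eqP; field.
Qed.

End Embeddings.

(** * Assembly of the three cases *)

Unset Implicit Arguments.
Set Strict Implicit.

Theorem theorem8 (R : realType) (d : nat) (nabla : nat -> seq (Lam d))
  (hd : (0 < d)%N) (hnabla : admissible_nabla R nabla)
  (q : \bar R) (hq : (0 < q)%E) (s : R) :
  (* (i) *)
  (forall p t : R, 1 <= p -> p < 2 -> d%:R / 2 < t ->
    exists c1 c2 : R, 0 < c1 /\ 0 < c2 /\ forall n : nat, (0 < n)%N ->
      ((c1 * n%:R `^ (- (t / d%:R)))%:E
         <= gelfand_width nabla (s + t) p%:E q s 2%:E 2%:E n
         <= (c2 * n%:R `^ (- (t / d%:R)))%:E)%E) /\
  (* (ii) *)
  (forall (p : \bar R) (t : R), (2%:E < p)%E -> 0 < t ->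
    exists c1 c2 : R, 0 < c1 /\ 0 < c2 /\ forall n : nat, (0 < n)%N ->
      ((c1 * n%:R `^ (- (t / d%:R)))%:E
         <= gelfand_width nabla (s + t) p q s 2%:E 2%:E n
         <= (c2 * n%:R `^ (- (t / d%:R)))%:E)%E) /\
  (* (iii) *)
  (forall p t : R, 0 < p -> p < 1 -> d%:R * (p^-1 - 2^-1) < t ->
    exists c1 c2 : R, 0 < c1 /\ 0 < c2 /\ forall n : nat, (0 < n)%N ->
      ((c1 * n%:R `^ (- (t / d%:R)))%:E
         <= gelfand_width nabla (s + t) p%:E q s 2%:E 2%:E n
         <= (c2 * n%:R `^ (- (t / d%:R) - 1 + p^-1))%:E)%E).
Proof.
have [un _] := hnabla; have [D [_ [_ [D0 _ hD _]]]] := admissible_size hnabla.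
have Dp (r : R) : 0 < D%:R `^ r by rewrite powR_gt0 // ltr0n.
have d0 : 0 < d%:R :> R by rewrite ltr0n.
split; [|split].
- move=> p t p1 p2 td; have p0 : (0 < p%:E)%E by rewrite lte_fin (lt_le_trans _ p1).
  have t0 : 0 < t by apply: le_lt_trans td; rewrite divr_ge0.
  have [c1 c10 lo] := gelfand_width_ge s hd hnabla p0 hq t0.
  have [c2 c20 up] := @upper_of_l1_decay R d nabla D hd D0 un hD
    (s + t) p%:E q p0 hq s t _ td (Dp (1 - p^-1))
    (fun a _ a1 j => l1_unit_ball_ge1 hD j p1 hq a1).
  by exists c1, c2; split=> //; split=> // n n0; rewrite lo ?up.
- move=> p t p2 t0; have p0 : (0 < p)%E by apply: lt_trans p2; rewrite lte_fin.
  have [c1 c10 lo] := gelfand_width_ge s hd hnabla p0 hq t0.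
  have [c2 c20 up] := @upper_of_l2_decay R d nabla D hd D0 un hD
    (s + t) p q p0 hq s t _ t0 (Dp (1 - 2 * invp p))
    (fun a _ a1 j => l2_unit_ball hD j p2 hq a1).
  by exists c1, c2; split=> //; split=> // n n0; rewrite lo ?up.
- move=> p t p0 p1 td; have p0' : (0 < p%:E)%E by rewrite lte_fin.
  have pi1 : 1 < p^-1 by rewrite invf_gt1.
  have t0 : 0 < t by apply: le_lt_trans td; rewrite mulr_ge0 //; lra.
  (* The hypothesis of (iii) is exactly the [l_1] condition for the reduced smoothness
     [t + d - d / p], which also produces the weaker exponent. *)
  have td' : d%:R / 2 < t + d%:R - d%:R / p by move: td; rewrite mulrBr; lra.
  have [c1 c10 lo] := gelfand_width_ge s hd hnabla p0' hq t0.
  have [c2 c20 up] := @upper_of_l1_decay R d nabla D hd D0 un hD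
    (s + t) p%:E q p0' hq s _ _ td' ltr01
    (fun a _ a1 j => l1_unit_ball_lt1 j p0 p1 hq a1).
  exists c1, c2; split=> //; split=> // n n0; rewrite lo //=.
  have -> : - (t / d%:R) - 1 + p^-1 = - ((t + d%:R - d%:R / p) / d%:R).
    by field; rewrite !gt_eqF.
  exact: up.
Qed.
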